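(* Let $\mathcal H$ be a Hilbert space and let $A,B$ be bounded linear operators on $\mathcal H$ such that $0<m\le A,B\le M$ for scalars $m,M$. Let $0\le t\le 1$. Then \[A\sharp_t B\le \frac{1}{K^2\left(\sqrt{\frac{m}{M}},\sqrt{\frac{M}{m}},t\right)}\,\frac{(M+m)^2}{4Mm}\,A\natural_t B.\]
   Context: For real scalars, $m\le A\le M$ means $mI\le A\le MI$ in the usual order on self-adjoint operators ($A\ge B$ iff $A-B$ is positive semi-definite); ''$m\le A,B\le M$'' means this holds for both $A$ and $B$. For positive definite $A,B$ and $0\le t\le 1$, the weighted geometric mean is $A\sharp_t B=A^{1/2}(A^{-1/2}BA^{-1/2})^{t}A^{1/2}$, $A\sharp B=A\sharp_{1/2}B$, and the weighted spectral geometric mean is $A\natural_t B=(A^{-1}\sharp B)^{t}A(A^{-1}\sharp B)^{t}$. The generalized Kantorovich constant is, for $0<a<b$ and $t\in\mathbb R$, \[K(a,b,t)=\frac{ab^t-ba^t}{(t-1)(b-a)}\left(\frac{t-1}{t}\,\frac{b^t-a^t}{ab^t-ba^t}\right)^t,\] with the value $1$ (the limiting value) when $t\in\{0,1\}$ or $a=b$. $K^2(\cdot)$ denotes the square of $K(\cdot)$. *)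

(* Defs.v *)
From HB Require Import structures.
From mathcomp Require Import all_boot all_order all_algebra.
From mathcomp Require Import complex.
From mathcomp Require Import all_classical all_reals all_analysis.

Set Implicit Arguments.
Unset Strict Implicit.
Unset Printing Implicit Defensive.

Import Order.TTheory GRing.Theory Num.Theory.
Import numFieldNormedType.Exports.

Local Open Scope classical_set_scope.
Local Open Scope ring_scope.
Local Open Scope complex_scope.

(* A complex Hilbert space is a complete normed module [H] over [R[i]] with an
   inner product [dot : {dot H for Num.conj}] (linear in its first argument) that
   induces the norm.  Operators are functions [H -> H]; all the operators
   below are limits and products of bounded linear ones, so that no bundled
   type is needed.  An everywhere defined operator is self-adjoint exactly
   when it is symmetric. *)
Section Operators.
Variables (R : realType) (H : completeNormedModType R[i]).
Variable dot : {dot H for Num.conj}.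
Implicit Types (A B X Y : H -> H) (a b t : R).

Definition norm_induced_by := forall x : H, `|x| ^+ 2 = dot x x.

Definition self_adjoint A := forall x y, dot (A x) y = dot x (A y).

(* In [R[i]], [0 <= z] says that [z] is real and nonnegative. *)
Definition positive_op A := self_adjoint A /\ forall x, 0 <= dot (A x) x.

Definition op_le A B := positive_op (fun x => B x - A x).

Definition op_scale a A : H -> H := fun x => a%:C *: A x.

Definition between a b A := op_le (op_scale a idfun) A /\ op_le A (op_scale b idfun).

Definition op_inv A : H -> H := xget A [set Y | cancel A Y /\ cancel Y A].

Definition op_horner (p : {poly R}) A : H -> H :=
  fun x => \sum_(i < size p) (p`_i)%:C *: iter i A x.

(* Convergence in operator norm. *)
Definition op_cvg (X_ : nat -> H -> H) X :=
  forall e : R, 0 < e ->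
    \forall n \near \oo, forall x, `|X_ n x - X x| <= e%:C * `|x|.

(* Continuous functional calculus for self-adjoint operators: [X] is [f(A)]
   when [p_n(A)] tends to [X] in norm for real polynomials [p_n] that tend to
   [f] uniformly on some interval [a, b] with [a <= A <= b], hence containing
   the spectrum of [A]. *)
Definition is_fun_calc (f : R -> R) A X :=
  exists (a b : R) (p : nat -> {poly R}),
    [/\ between a b A,
        {uniform `[a, b], (fun n => horner (p n)) @ \oo --> f} &
        op_cvg (fun n => op_horner (p n) A) X].

Definition fun_calc f A : H -> H := xget A [set X | is_fun_calc f A X].

Definition op_pow A t : H -> H := fun_calc (fun s : R => s `^ t) A.

Definition geom_mean t A B : H -> H :=
  let S := op_pow A (1 / 2) in
  let S' := op_pow A (- (1 / 2)) in
  S \o op_pow (S' \o B \o S') t \o S.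

Definition spectral_geom_mean t A B : H -> H :=
  let C := op_pow (geom_mean (1 / 2) (op_inv A) B) t in
  C \o A \o C.

End Operators.

Definition kantorovich (R : realType) (a b t : R) : R :=
  if [|| t == 0, t == 1 | a == b] then 1
  else (a * b `^ t - b * a `^ t) / ((t - 1) * (b - a)) *
       ((t - 1) / t * ((b `^ t - a `^ t) / (a * b `^ t - b * a `^ t))) `^ t.

(* Main.v *)
(* Let [S = A^(1/2)], [T = (S B S)^(1/2)], [C = A^-1 # B = S^-1 T S^-1] and
   [D = S^-1 B S^-1], so that [A #_t B = S D^t S] and [A nat_t B = C^t A C^t].
   Put [x = S v].  On one side, Cauchy-Schwarz and the chord of the concave function
   [s^t] over the spectrum of [C] give
     |S C^t x| |v| >= <C^t x, x> >= c <Tv, v> + d <Av, v>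
                   >= K <Av, v>^(1-t) <Tv, v>^t.
   On the other side, tangents to [s^t] give
     <D^t A v, A v> <= |Av|^(2(1-t)) |Tv|^(2t),
   and Kantorovich's inequality bounds [|Av| |v|] and [|Tv| |v|] by
   [(M + m) / (2 sqrt (M m))] times [<Av, v>] and [<Tv, v>], as [m <= A, T <= M].  The
   spectrum of [C] lies in [[sqrt (m/M), sqrt (M/m)]] because [(m/M) A^2 <= T^2 <= (M/m) A^2]
   and the square root is operator monotone. *)

Require Import Defs.
From mathcomp Require Import all_boot all_order all_algebra.
From mathcomp Require Import complex ring lra zify.
From mathcomp Require Import all_classical all_reals all_analysis.
Set Implicit Arguments.
Unset Strict Implicit.
Unset Printing Implicit Defensive.
Import Order.TTheory GRing.Theory Num.Theory.
Import numFieldNormedType.Exports.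
Local Open Scope classical_set_scope.
Local Open Scope ring_scope.

(** * The real inner product [Re <x, y>] *)

(** [C] and [D] are different operators, so no common functional calculus compares [C^t] with [D^t].
    Everything is therefore reduced to scalars attached to one vector [v], and the two sides meet
    only through [<D A v, A v> = |T v|^2]. With [p = <A v, v>], [q = <T v, v>] and
    [E = p^(1-t) q^t], one side gives [K^2 E^2 <= |S C^t x|^2 |v|^2] and the other [<D^t A v, A v>
    |v|^2 <= (M + m)^2 / (4 M m) E^2]; eliminating [E] leaves the stated constant. [K] is squared
    because Cauchy-Schwarz only bounds the norm of [S C^t x], while the spectral mean is the square
    of that norm. The functional calculus is given by polynomial approximation alone. Its properties
    all rest on one algebraic fact: a real polynomial nonnegative on [[a, b]] is generated from
    nonnegative constants by sums and by products with squares, ['X - a] and [b - 'X], hence is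
    positive at any [A] with [a <= A <= b]. *)

Definition real_linear (R : realType) (H : lmodType R[i]) (Z : H -> H) :=
  (forall x y, Z (x + y) = Z x + Z y) /\ forall (a : R) x, Z (a%:C%C *: x) = a%:C%C *: Z x.

Lemma ReD (R : rcfType) (u v : R[i]) : complex.Re (u + v) = complex.Re u + complex.Re v.
Proof. by case: u v => [? ?] [? ?]. Qed.

Lemma ReN (R : rcfType) (u : R[i]) : complex.Re (- u) = - complex.Re u.
Proof. by case: u. Qed.

Lemma ReZ (R : rcfType) (a : R) (u : R[i]) : complex.Re (a%:C%C * u) = a * complex.Re u.
Proof. by case: u => [? ?]; rewrite /GRing.mul /= mul0r subr0. Qed.

Lemma Re_conj (R : rcfType) (u : R[i]) : complex.Re (u^*)%R = complex.Re u.
Proof. by case: u. Qed.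

Lemma Im_conj (R : rcfType) (u : R[i]) : complex.Im (u^*)%R = - complex.Im u.
Proof. by case: u. Qed.

Section RealInnerProduct.
Variables (R : realType) (H : completeNormedModType R[i]).
Variable dot : {dot H for Num.conj}.
Hypothesis Hdot : norm_induced_by dot.
Implicit Types (x y : H) (a b : R) (A B : H -> H).

Definition rdot x y : R := complex.Re (dot x y).
Definition nrm x : R := complex.Re `|x|.

Lemma rdotDl x y (z : H) : rdot (x + y) z = rdot x z + rdot y z.
Proof. by rewrite /rdot linearDl ReD. Qed.

Lemma rdotC x y : rdot x y = rdot y x.
Proof. by rewrite /rdot hermC expr0 mul1r Re_conj. Qed.

Lemma rdotDr x y (z : H) : rdot z (x + y) = rdot z x + rdot z y.
Proof. by rewrite rdotC rdotDl !(rdotC z). Qed.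

Lemma rdotZl a x y : rdot (a%:C%C *: x) y = a * rdot x y.
Proof. by rewrite /rdot linearZl_LR ReZ. Qed.

Lemma rdotZr a x y : rdot x (a%:C%C *: y) = a * rdot x y.
Proof. by rewrite rdotC rdotZl rdotC. Qed.

Lemma rdotNl x y : rdot (- x) y = - rdot x y.
Proof. by rewrite /rdot linearNl ReN. Qed.

Lemma rdotNr x y : rdot x (- y) = - rdot x y.
Proof. by rewrite rdotC rdotNl rdotC. Qed.

Lemma rdot0l x : rdot 0 x = 0.
Proof. by rewrite -[in LHS](subrr 0) rdotDl rdotNl subrr. Qed.

Lemma normE x : `|x| = (nrm x)%:C%C.
Proof. by rewrite /nrm RRe_real // ger0_real. Qed.

Lemma nrm_ge0 x : 0 <= nrm x.
Proof. by rewrite -ler0c -normE. Qed.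

Lemma nrm_sq x : nrm x ^+ 2 = rdot x x.
Proof. by rewrite /rdot -Hdot normE -rmorphXn. Qed.

Lemma rdot_ge0 x : 0 <= rdot x x.
Proof. by rewrite -nrm_sq exprn_ge0 // nrm_ge0. Qed.

Lemma nrmD x y : nrm (x + y) <= nrm x + nrm y.
Proof. by have := ler_normD x y; rewrite !normE lecE => /andP[_]. Qed.

Lemma nrmN x : nrm (- x) = nrm x.
Proof. by rewrite /nrm normrN. Qed.

Lemma nrmBC x y : nrm (x - y) = nrm (y - x).
Proof. by rewrite -nrmN opprB. Qed.

Lemma nrmB x y (z : H) : nrm (x - z) <= nrm (x - y) + nrm (y - z).
Proof. by have := nrmD (x - y) (y - z); rewrite addrA subrK. Qed.

Lemma nrmi x : nrm ('i%C *: x) = nrm x.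
Proof.
have := normrZ 'i%C x; rewrite !normE normc_def /= expr0n add0r expr1n sqrtr1.
by move/(congr1 (@complex.Re R)); rewrite ReZ mul1r.
Qed.

Lemma nrm_eq0 x : nrm x = 0 -> x = 0.
Proof. by move=> h; apply/normr0_eq0; rewrite normE h. Qed.

Lemma nrm0 : nrm 0 = 0.
Proof. by rewrite /nrm normr0. Qed.

Lemma small_eq0 (r c : R) : 0 <= r -> (forall e, 0 < e -> r <= e * c) -> r = 0.
Proof.
move=> r0 h; apply/eqP; rewrite eq_le r0 andbT.
have d0 : 0 < `|c| + 1 by rewrite ltr_wpDl.
apply/ler_addgt0Pl => e e0; rewrite addr0.
have := h (e / (`|c| + 1)) (divr_gt0 e0 d0); move/le_trans; apply.
rewrite -mulrA ger_pMr // mulrC ler_pdivrMr // mul1r.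
by rewrite (le_trans (ler_norm _)) // lerDl.
Qed.

Lemma nrm_small x c : (forall e, 0 < e -> nrm x <= e * c) -> x = 0.
Proof. by move=> h; apply: nrm_eq0; apply: small_eq0 h; exact: nrm_ge0. Qed.

Lemma rdot_le x y : rdot x y <= nrm x * nrm y.
Proof.
have [h|h] := eqVneq (nrm x * nrm y) 0.
  rewrite h; move/eqP: h; rewrite mulf_eq0 => /orP[] /eqP/nrm_eq0 ->.
    by rewrite rdot0l.
  by rewrite rdotC rdot0l.
have h0 : 0 < nrm x * nrm y by rewrite lt_neqAle eq_sym h mulr_ge0 ?nrm_ge0.
have := rdot_ge0 ((nrm y)%:C%C *: x - (nrm x)%:C%C *: y).
rewrite !(rdotDl, rdotDr, rdotNl, rdotNr, rdotZl, rdotZr) (rdotC y x) -!nrm_sq.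
move=> k; rewrite -(ler_pM2l h0); move: k; set p := nrm x; set q := nrm y.
by set r := rdot x y; nra.
Qed.

Lemma abs_rdot_le x y : `|rdot x y| <= nrm x * nrm y.
Proof. by rewrite ler_norml rdot_le andbT lerNl -rdotNl (le_trans (rdot_le _ _)) // nrmN. Qed.

(** Symmetry forces linearity: moving [A] onto [z] shows that [A (x + y)] and [A x + A y] have the
    same inner product with every [z]. *)
Lemma self_adjoint_real_linear A : self_adjoint dot A -> real_linear A.
Proof.
have ext u v : (forall z, rdot u z = rdot v z) -> u = v.
  move=> h; apply/eqP; rewrite -subr_eq0; apply/eqP/nrm_eq0.
  by apply/eqP; rewrite -sqrf_eq0 nrm_sq rdotDl h -rdotDl subrr rdot0l.
move=> sA; have rA x y : rdot (A x) y = rdot x (A y) by rewrite /rdot sA.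
by split=> [x y|a x]; apply: ext => z; rewrite ?(rdotDl, rdotZl, rA).
Qed.

Lemma self_adjoint_rdot A : self_adjoint dot A -> forall x y, rdot (A x) y = rdot x (A y).
Proof. by move=> sA x y; rewrite /rdot sA. Qed.

(** The imaginary part of [dot (A x) y] is minus the real part of [dot (A ('i *: x)) y], so real
    symmetry at ['i *: x] supplies it. *)
Lemma self_adjointP A : (forall x y, rdot (A x) y = rdot x (A y)) ->
  (forall x, A ('i%C *: x) = 'i%C *: A x) -> self_adjoint dot A.
Proof.
move=> rA iA x y; have := rA x y; have := rA ('i%C *: x) y.
rewrite /rdot iA !linearZl_LR /=.
case: (dot (A x) y) (dot x (A y)) => [a b] [c d] /=.
by rewrite !mul0r !sub0r !mul1r => /oppr_inj -> ->.
Qed.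

Lemma self_adjoint_i A x : self_adjoint dot A -> A ('i%C *: x) = 'i%C *: A x.
Proof.
move=> sA; apply/eqP; rewrite -subr_eq0; apply/eqP/nrm_eq0/eqP.
rewrite -sqrf_eq0 nrm_sq /rdot; set y := _ - _.
by rewrite {1}/y linearBl /= linearZl_LR /= !sA linearZl_LR /= subrr.
Qed.

Lemma real_linear0 A : real_linear A -> A 0 = 0.
Proof. by case=> _ /(_ 0 0); rewrite scale0r => ->; rewrite scale0r. Qed.

Lemma real_linearN A x : real_linear A -> A (- x) = - A x.
Proof.
by case=> _ /(_ (-1) x); rewrite rmorphN rmorph1 !scaleN1r.
Qed.

Lemma real_linearB A x y : real_linear A -> A (x - y) = A x - A y.
Proof. by move=> lA; rewrite lA.1 real_linearN. Qed.

Definition bnd a b A := self_adjoint dot A /\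
  forall x, a * rdot x x <= rdot (A x) x <= b * rdot x x.

(** The order of [R[i]] also demands equal imaginary parts; Hermitian symmetry makes the form of a
    self-adjoint operator real. *)
Lemma op_leP A B : self_adjoint dot A -> self_adjoint dot B ->
  (forall x, rdot (A x) x <= rdot (B x) x) -> op_le dot A B.
Proof.
move=> sA sB h; have sd : self_adjoint dot (fun x => B x - A x).
  by move=> x y; rewrite linearBl linearBr /= sA sB.
split=> // x; have := h x; rewrite lecE -subr_ge0 -rdotNl -rdotDl => ->.
rewrite andbT; have := sd x x; rewrite [RHS]hermC expr0 mul1r.
by move/(congr1 (@complex.Im R)); rewrite Im_conj => hv; apply/eqP; lra.
Qed.

Lemma self_adjoint_scale a A : self_adjoint dot A -> self_adjoint dot (op_scale a A).
Proof.
move=> sA x y; rewrite /op_scale /= linearZl_LR linearZr_LR /= sA; congr (_ * _).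
by apply/esym/CrealP; rewrite complex_real.
Qed.

Lemma self_adjoint_id : self_adjoint dot idfun.
Proof. by []. Qed.

Lemma betweenP a b A : between dot a b A <-> bnd a b A.
Proof.
split=> [[[s1 h1] [_ h2]]|[sA h]].
  have sA : self_adjoint dot A.
    move=> x y; have := s1 x y; have := self_adjoint_scale a self_adjoint_id x y.
    by rewrite /op_scale /= linearBl linearBr /= => ->; move/addIr.
  split=> // x; have := h1 x; have := h2 x; rewrite /op_scale /= !lecE /=.
  move=> /andP[_]; rewrite -/(rdot _ x) rdotDl rdotNl rdotZl subr_ge0 => ->.
  by move=> /andP[_]; rewrite -/(rdot _ x) rdotDl rdotNl rdotZl subr_ge0 => ->.
by split; apply: op_leP => //; try (apply: self_adjoint_scale; exact: self_adjoint_id);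
  move=> x; rewrite /op_scale rdotZl; case/andP: (h x).
Qed.

End RealInnerProduct.

(** * Polynomials of an operator *)

Section Horner.
Variables (R : realType) (H : completeNormedModType R[i]).
Implicit Types (x y : H) (A Z : H -> H) (p q : {poly R}).

Lemma real_linear_sum A n (F : 'I_n -> H) : real_linear A ->
  A (\sum_i F i) = \sum_i A (F i).
Proof. by move=> lA; apply: (big_morph A lA.1 (real_linear0 lA)). Qed.

Lemma real_linear_iter A i : real_linear A -> real_linear (iter i A).
Proof.
move=> lA; elim: i => [//|i [IH1 IH2]].
by split=> [x y|a x] /=; rewrite ?IH1 ?IH2 ?lA.1 ?lA.2.
Qed.

Lemma op_hornerE n p A x : (size p <= n)%N ->
  op_horner p A x = \sum_(i < n) (p`_i)%:C%C *: iter i A x.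
Proof.
move=> h; rewrite /op_horner (big_ord_widen n (fun i => (p`_i)%:C%C *: iter i A x)) //.
rewrite big_mkcond; apply: eq_bigr => i _; case: ltnP => // hi.
by rewrite nth_default // scale0r.
Qed.

Lemma op_hornerD p q A x : op_horner (p + q) A x = op_horner p A x + op_horner q A x.
Proof.
have h := size_polyD p q; rewrite (op_hornerE _ _ h).
rewrite (op_hornerE _ _ (leq_maxl (size p) (size q))).
rewrite (op_hornerE _ _ (leq_maxr (size p) (size q))) -big_split.
by apply: eq_bigr => i _; rewrite coefD rmorphD scalerDl.
Qed.

Lemma op_hornerZ a p A x : op_horner (a *: p) A x = a%:C%C *: op_horner p A x.
Proof.
rewrite (op_hornerE _ _ (size_scale_leq a p)) scaler_sumr.
by apply: eq_bigr => i _; rewrite coefZ rmorphM scalerA.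
Qed.

Lemma op_hornerN p A x : op_horner (- p) A x = - op_horner p A x.
Proof. by rewrite -scaleN1r op_hornerZ rmorphN rmorph1 scaleN1r. Qed.

Lemma op_hornerB p q A x : op_horner (p - q) A x = op_horner p A x - op_horner q A x.
Proof. by rewrite op_hornerD op_hornerN. Qed.

Lemma op_hornerC a A x : op_horner a%:P A x = a%:C%C *: x.
Proof. by rewrite (op_hornerE _ _ (size_polyC_leq1 a)) big_ord1 coefC. Qed.

Lemma op_hornerX A x : op_horner 'X A x = A x.
Proof.
have h : (size ('X : {poly R}) <= 2)%N by rewrite size_polyX.
rewrite (op_hornerE _ _ h) !big_ord_recl big_ord0 !coefX /=.
by rewrite scale0r add0r addr0 scale1r.
Qed.

Lemma op_hornerXM p A x : real_linear A -> op_horner ('X * p) A x = A (op_horner p A x).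
Proof.
move=> lA; have h : (size ('X * p)%R <= (size p).+1)%N.
  by rewrite (leq_trans (size_polyMleq _ _)) // size_polyX.
rewrite (op_hornerE _ _ h) big_ord_recl coefXM /= scale0r add0r real_linear_sum //.
by apply: eq_bigr => i _; rewrite coefXM /= lA.2.
Qed.

Lemma op_horner_commute p A Z x : real_linear Z -> (forall y, Z (A y) = A (Z y)) ->
  Z (op_horner p A x) = op_horner p A (Z x).
Proof.
move=> lZ c; rewrite real_linear_sum //; apply: eq_bigr => i _; rewrite lZ.2.
by congr (_ *: _); elim: (nat_of_ord i) => //= n IH; rewrite c IH.
Qed.

Lemma real_linear_horner p A : real_linear A -> real_linear (op_horner p A).
Proof.
move=> lA; split=> [x y|a x].
  rewrite -big_split; apply: eq_bigr => i _.
  by rewrite (real_linear_iter i lA).1 scalerDr.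
rewrite scaler_sumr; apply: eq_bigr => i _.
by rewrite (real_linear_iter i lA).2 !scalerA mulrC.
Qed.

Lemma op_hornerM p q A x : real_linear A ->
  op_horner (p * q) A x = op_horner p A (op_horner q A x).
Proof.
move=> lA; elim/poly_ind: p x => [|p c IH] x.
  by rewrite mul0r -polyC0 !op_hornerC !scale0r.
rewrite mulrDl -mulrA mulrCA op_hornerD mul_polyC op_hornerZ op_hornerXM // IH.
by rewrite op_hornerD op_hornerC (mulrC p) op_hornerXM.
Qed.

End Horner.

Section HornerOrder.
Variables (R : realType) (H : completeNormedModType R[i]).
Variable dot : {dot H for Num.conj}.
Hypothesis Hdot : norm_induced_by dot.
Implicit Types (x y : H) (A Z : H -> H) (p q : {poly R}).


Lemma self_adjoint_iter A i : self_adjoint dot A -> self_adjoint dot (iter i A).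
Proof. by move=> sA; elim: i => // i IH x y; rewrite [in RHS]iterSr -IH -sA. Qed.

Lemma self_adjoint_horner p A : self_adjoint dot A -> self_adjoint dot (op_horner p A).
Proof.
move=> sA x y; rewrite /op_horner linear_sumr linear_sumlz /=.
apply: eq_bigr => i _; rewrite linearZl_LR linearZr_LR /= self_adjoint_iter //.
by congr (_ * _); apply/esym/CrealP; rewrite complex_real.
Qed.

End HornerOrder.

(** * Polynomials nonnegative on an interval *)

Section PolyPositivity.
Variable R : realType.
Implicit Types (p q : {poly R}) (a b u v s : R).

(** A negative value at [u] would persist nearby by continuity, and [a < b] leaves room in the
    interval on at least one side of [u]. *)
Lemma horner_ge0_closure p a b u : a < b -> a <= u <= b ->
  (forall s, a <= s <= b -> s != u -> 0 <= p.[s]) -> 0 <= p.[u].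
Proof.
move=> ab /andP[au ub] h; rewrite leNgt; apply/negP => pu.
have cp : {for u, continuous (horner p)} by exact: continuous_horner.
have /cvgrPdist_lt /(_ _ (_ : 0 < - p.[u])) := cp.
rewrite oppr_gt0 => /(_ pu) /nbhs_ballP[d /= d0 hd].
have near s : a <= s <= b -> s != u -> `|u - s| < d -> False.
  move=> sab su sd; have := hd s sd; have := h s sab su.
  by rewrite ltr_norml /=; lra.
have [ub'|ub'] := ltP u b.
  apply: (near (Num.min b (u + d / 2))).
  - by case: (leP b (u + d / 2)); lra.
  - by case: (leP b (u + d / 2)) => ?; apply/eqP; lra.
  - by rewrite ltr_norml; case: (leP b (u + d / 2)); lra.
apply: (near (Num.max a (u - d / 2))).
- by case: (leP a (u - d / 2)); lra.
- by case: (leP a (u - d / 2)) => ?; apply/eqP; lra.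
- by rewrite ltr_norml; case: (leP a (u - d / 2)); lra.
Qed.

Lemma poly_complex_root p : (1 < size p)%N -> exists u v,
  root (map_poly (fun x : R => x%:C%C) p) (u +i* v)%C.
Proof.
move=> sp; have : size (map_poly (fun x : R => x%:C%C) p) != 1.
  by rewrite size_map_poly gtn_eqF.
by move/closed_rootP => [[u v] r]; exists u, v.
Qed.

(** The remainder modulo the real quadratic is some [r1 X + r0] vanishing at [u + iv]: the imaginary
    part [r1 v] kills [r1], then the real part kills [r0]. *)
Lemma dvdp_conj_roots p u v : v != 0 ->
  root (map_poly (fun x : R => x%:C%C) p) (u +i* v)%C -> ('X - u%:P) ^+ 2 + (v ^+ 2)%:P %| p.
Proof.
move=> v0 rp; set d := _ + _.
have sd : size d = 3.
  by rewrite size_polyDl size_exp_XsubC // (leq_ltn_trans (size_polyC_leq1 _)).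
have sr : (size (p %% d)%R < size d)%N by rewrite ltn_modp -size_poly_eq0 sd.
rewrite sd ltnS in sr.
rewrite /dvdp; set r := p %% d in sr *.
have er : r = (r`_1)%:P * 'X + (r`_0)%:P.
  apply/polyP => -[|[|i]]; rewrite coefD coefMX !coefC /= ?add0r ?addr0 //.
  by rewrite nth_default // (leq_trans sr).
have rd : (map_poly (real_complex R) d).[(u +i* v)%C] = 0.
  rewrite rmorphD rmorphXn rmorphB /= map_polyX !map_polyC hornerD horner_exp !hornerE.
  by apply/eqP; rewrite eq_complex /= !expr2 /=; apply/andP; split; apply/eqP; ring.
move: rp; rewrite (divp_eq p d) -/r /root rmorphD hornerD rmorphM hornerM rd mulr0 add0r.
rewrite er rmorphD rmorphM /= map_polyX !map_polyC !hornerE eq_complex /=.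
rewrite !mul0r subr0 !addr0 mulf_eq0 (negPf v0) orbF => /andP[/eqP r0 /eqP r1].
by move: r0; rewrite r1 mul0r add0r => ->; rewrite mul0r add0r.
Qed.

(* Induction on the degree: a root outside [[a, b]] or at an end contributes
   ['X - a] or [b - 'X] up to a positive constant, an interior root is double, and
   non-real roots come in conjugate pairs. *)
Lemma nonneg_poly_ind (a b : R) (P : {poly R} -> Prop) : a < b ->
  (forall c, 0 <= c -> P c%:P) ->
  (forall p q, P p -> P q -> P (p + q)) ->
  (forall p r, P p -> P (r ^+ 2 * p)) ->
  (forall p, P p -> P (('X - a%:P) * p)) ->
  (forall p, P p -> P ((b%:P - 'X) * p)) ->
  forall p, (forall s, a <= s <= b -> 0 <= p.[s]) -> P p.
Proof.
move=> ab PC PD PS Pa Pb p; have [n] := ubnP (size p).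
elim: n p => // n IH p sp pos.
have [s1|s1] := leqP (size p) 1.
  have pa : 0 <= p.[a] by apply: pos; rewrite lexx ltW.
  by rewrite (size1_polyC s1); apply: PC; move: pa; rewrite {1}(size1_polyC s1) hornerC.
have [u [v]] := poly_complex_root s1.
have [->|v0] := eqVneq v 0; last first.
  move=> /(dvdp_conj_roots v0) /dvdpP[k ek].
  have k0 : k != 0 by apply: contraL s1 => /eqP k0; rewrite ek k0 mul0r size_poly0.
  have sd : size (('X - u%:P) ^+ 2 + (v ^+ 2)%:P : {poly R}) = 3.
    by rewrite size_polyDl size_exp_XsubC // (leq_ltn_trans (size_polyC_leq1 _)).
  have Pk : P k.
    apply: IH => [|s hs].
      move: sp; rewrite ek size_mul // -?size_poly_eq0 sd //.
      by case: (size k) k0 (size_poly_eq0 k) => [|m] // _ _; lia.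
    have := pos s hs; rewrite ek hornerM pmulr_lge0 //.
    rewrite !hornerE; have := sqr_ge0 (s - u); have : 0 < v ^+ 2 by rewrite exprn_even_gt0.
    by rewrite !expr2; lra.
  by rewrite ek mulrC mulrDl; apply: PD; [exact: PS|rewrite rmorphXn; exact: PS].
have -> : root (map_poly (real_complex R) p) (u +i* 0)%C = root p u.
  by rewrite complexr0 fmorph_root.
move=> /factor_theorem[q eq].
have q0 : q != 0 by apply: contraL s1 => /eqP q0; rewrite eq q0 mul0r size_poly0.
have sq : (size q < n)%N.
  by move: sp; rewrite eq size_mul ?polyXsubC_eq0 // size_XsubC addn2.
have pq s : p.[s] = q.[s] * (s - u) by rewrite eq !hornerE.
have [ua|ua] := leP u a.
  have Pq : P q.
    apply: IH => // s hs; have [->|sa] := eqVneq s a.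
      apply: (@horner_ge0_closure q a b) => // [|s' hs' sa'].
        by rewrite lexx ltW.
      have := pos s' hs'; rewrite pq pmulr_lge0 //; rewrite subr_gt0 (le_lt_trans ua) //.
      by rewrite lt_neqAle eq_sym sa'; case/andP: hs'.
    have := pos s hs; rewrite pq pmulr_lge0 //; rewrite subr_gt0 (le_lt_trans ua) //.
    by rewrite lt_neqAle eq_sym sa; case/andP: hs.
  have -> : p = ('X - a%:P) * q + (a - u)%:P * q.
    by rewrite eq polyCB; ring.
  apply: PD; first exact: Pa.
  rewrite -[a - u]sqr_sqrtr ?subr_ge0 // rmorphXn; exact: PS.
have [ub|ub] := leP b u.
  have Pq : P (- q).
    apply: IH => [|s hs]; first by rewrite size_polyN.
    have [->|sb] := eqVneq s b.
      apply: (@horner_ge0_closure _ a b) => // [|s' hs' sb'].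
        by rewrite lexx ltW.
      have := pos s' hs'; rewrite pq hornerN -mulrNN pmulr_lge0 //.
      rewrite oppr_gt0 subr_lt0 (lt_le_trans _ ub) //.
      by rewrite lt_neqAle sb'; case/andP: hs'.
    have := pos s hs; rewrite pq hornerN -mulrNN pmulr_lge0 //.
    rewrite oppr_gt0 subr_lt0 (lt_le_trans _ ub) //.
    by rewrite lt_neqAle sb; case/andP: hs.
  have -> : p = (b%:P - 'X) * (- q) + (u - b)%:P * (- q).
    by rewrite eq polyCB; ring.
  apply: PD; first exact: Pb.
  rewrite -[u - b]sqr_sqrtr ?subr_ge0 // rmorphXn; exact: PS.
(* As [p = q * ('X - u)] is nonnegative on both sides of [u], [q] passes from nonpositive to
   nonnegative there; its zero makes [u] a double root. *)
have qu : q.[u] = 0.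
  apply/eqP; rewrite eq_le -oppr_ge0 -hornerN; apply/andP; split.
    apply: (@horner_ge0_closure _ a u) => // [|s hs su]; first by rewrite lexx ltW.
    have := pos s; rewrite pq hornerN -mulrNN pmulr_lge0; last by lra.
    by apply; lra.
  apply: (@horner_ge0_closure _ u b) => // [|s hs su]; first by rewrite lexx ltW.
  by have := pos s; rewrite pq pmulr_lge0; [apply; lra|lra].
have /factor_theorem[r er] : root q u by rewrite /root qu.
have r0 : r != 0 by apply: contraNneq q0 => r0; rewrite er r0 mul0r.
have -> : p = ('X - u%:P) ^+ 2 * r by rewrite eq er; ring.
apply: PS; apply: IH => [|s hs].
  by move: sq; rewrite er size_mul ?polyXsubC_eq0 // size_XsubC addn2; apply: ltn_trans.
have rpos s' : a <= s' <= b -> s' != u -> 0 <= r.[s'].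
  move=> hs' su; have := pos s' hs'; rewrite pq er !hornerE -mulrA pmulr_lge0 //.
  by rewrite -expr2 exprn_even_gt0 //= subr_eq0.
have [->|su] := eqVneq s u; last exact: rpos.
by apply: (@horner_ge0_closure _ a b) => //; rewrite !ltW.
Qed.

End PolyPositivity.

Lemma inv_nat_small (R : realType) (e : R) : 0 < e ->
  exists n0 : nat, forall n, (n0 <= n)%N -> n.+1%:R^-1 <= e.
Proof.
move=> e0; exists (Num.bound e^-1) => n hn.
have := archi_boundP (ltW (_ : 0 < e^-1)); rewrite invr_gt0 => /(_ e0) h.
rewrite invf_ple ?posrE ?ltr0n //; apply: (le_trans (ltW h)).
by rewrite ler_nat (leq_trans hn).
Qed.

(** * Continuous functional calculus *)

Section SpectralBounds.
Variables (R : realType) (H : completeNormedModType R[i]).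
Variable dot : {dot H for Num.conj}.
Hypothesis Hdot : norm_induced_by dot.
Implicit Types (x y : H) (A Z F G : H -> H) (p q : {poly R}) (a b e s : R) (f g : R -> R).
Local Notation nrm := (@nrm R H).

Lemma self_adjointB A F : self_adjoint dot A -> self_adjoint dot F ->
  self_adjoint dot (fun x => A x - F x).
Proof. by move=> sA sF x y; rewrite linearBl linearBr /= sA sF. Qed.

(** Polarisation at [x + G x]: the two cross terms add up to [2 |G x|^2]. *)
Lemma self_adjoint_quad0 G x : self_adjoint dot G -> (forall y, rdot dot (G y) y = 0) -> G x = 0.
Proof.
move=> sG G0; have lG := self_adjoint_real_linear Hdot sG.
apply/nrm_eq0/eqP; rewrite -sqrf_eq0 (nrm_sq Hdot); apply/eqP.
have := G0 (x + G x); rewrite lG.1 !(rdotDl, rdotDr) !G0.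
by rewrite (self_adjoint_rdot sG (G x)); lra.
Qed.

Lemma bnd_degenerate a A x : bnd dot a a A -> A x = a%:C%C *: x.
Proof.
case=> sA h; apply/eqP; rewrite -subr_eq0; apply/eqP.
apply: (self_adjoint_quad0 x (self_adjointB sA (self_adjoint_scale a (self_adjoint_id dot)))) => y.
by rewrite rdotDl rdotNl rdotZl; apply/eqP; rewrite subr_eq0 eq_le andbC; apply: h.
Qed.

Lemma bnd_nrm0 a b A x : bnd dot a b A -> ~~ (a <= b) -> nrm x = 0.
Proof.
move=> [_ bA]; rewrite -ltNge => ba; apply/eqP; rewrite -sqrf_eq0 (nrm_sq Hdot).
have := rdot_ge0 Hdot x; have := bA x; have [//|r0] := eqVneq (rdot dot x x) 0.
rewrite le0r (negPf r0) /= => /andP[h1 h2] r1; move: (le_trans h1 h2).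
by rewrite ler_pM2r //; lra.
Qed.

(** Stands in for the spectral theorem: nonnegativity on the interval is turned into an algebraic
    certificate, which is then evaluated at [A]. *)
Lemma op_horner_ge0 a b A p : bnd dot a b A ->
  (forall s, a <= s <= b -> 0 <= p.[s]) -> forall x, 0 <= rdot dot (op_horner p A x) x.
Proof.
move=> hA pos; have [sA bA] := hA; have lA := self_adjoint_real_linear Hdot sA.
have [ab|ba|eab] := ltgtP a b; last first.
- move=> x; rewrite -eab in hA; have /factor_theorem[q eq] : root (p - p.[a]%:P) a.
    by rewrite /root !hornerE subrr.
  have -> : p = q * ('X - a%:P) + p.[a]%:P by rewrite -eq subrK.
  rewrite op_hornerD op_hornerM // op_hornerB op_hornerX !op_hornerC (bnd_degenerate _ hA).
  rewrite subrr (real_linear0 (real_linear_horner q lA)) add0r rdotZl.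
  by rewrite mulr_ge0 // ?(rdot_ge0 Hdot) // pos // -eab lexx.
- by move=> x; rewrite (nrm_eq0 (bnd_nrm0 x hA _)) -?ltNge // rdotC rdot0l.
pose Q q := forall x, 0 <= rdot dot (op_horner q A x) x.
have Qe p1 p2 : p1 = p2 -> Q p1 -> Q p2 by move->.
have QD p1 p2 : Q p1 -> Q p2 -> Q (p1 + p2).
  by move=> h1 h2 x; rewrite op_hornerD rdotDl addr_ge0.
have QZ c p1 : 0 <= c -> Q p1 -> Q (c *: p1).
  by move=> c0 h1 x; rewrite op_hornerZ rdotZl mulr_ge0.
have QS p1 r : Q p1 -> Q (r ^+ 2 * p1).
  move=> h x; rewrite expr2 -mulrA op_hornerM //.
  by rewrite (self_adjoint_rdot (self_adjoint_horner r sA)) mulrC op_hornerM.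
have Q1 : Q 1%:P by move=> x; rewrite op_hornerC rdotZl mul1r (rdot_ge0 Hdot).
have Qa : Q ('X - a%:P).
  move=> x; rewrite op_hornerB op_hornerX op_hornerC rdotDl rdotNl rdotZl subr_ge0.
  by case/andP: (bA x).
have Qb : Q (b%:P - 'X).
  move=> x; rewrite op_hornerB op_hornerX op_hornerC rdotDl rdotNl rdotZl subr_ge0.
  by case/andP: (bA x).
(* The factors ['X - a] and [b - 'X] add up to [b - a], so [b - a] times their product is a sum of
   squares times one factor each. *)
have Qab : Q (('X - a%:P) * (b%:P - 'X)).
  have ba0 : b - a != 0 by lra.
  apply: (Qe ((b - a)^-1 *:
    (('X - a%:P) ^+ 2 * (b%:P - 'X) + (b%:P - 'X) ^+ 2 * ('X - a%:P)))).
    apply: (scalerI ba0); rewrite scalerA divff // scale1r -mul_polyC polyCB; ring.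
  by apply: QZ; [rewrite invr_ge0; lra | apply: QD; apply: QS].
(* Keeping track of these four products makes the property stable under
   multiplication by ['X - a] and [b - 'X]. *)
pose P q := [/\ Q q, Q (('X - a%:P) * q), Q ((b%:P - 'X) * q) &
                Q (('X - a%:P) * (b%:P - 'X) * q)].
suff [] : P p by [].
apply: (nonneg_poly_ind ab) pos =>
  [c c0|p1 p2 [? ? ? ?] [? ? ? ?]|p1 r [? ? ? ?]|p1 [? ? ? ?]|p1 [? ? ? ?]].
- split; [rewrite -[c%:P]mulr1|..]; rewrite ?[_ * c%:P]mulrC mul_polyC; exact: QZ.
- by split; rewrite ?(mulrDr _ p1); apply: QD.
- by split; rewrite ?(mulrCA _ (r ^+ 2)); apply: QS.
- split=> //; [rewrite mulrA -expr2; exact: QS| |].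
    by apply: (Qe (('X - a%:P) * (b%:P - 'X) * p1)) => //; ring.
  by apply: (Qe (('X - a%:P) ^+ 2 * ((b%:P - 'X) * p1))); [ring|apply: QS].
- split=> //; [|rewrite mulrA -expr2; exact: QS|].
    by rewrite mulrA.
  by apply: (Qe ((b%:P - 'X) ^+ 2 * (('X - a%:P) * p1))); [ring|apply: QS].
Qed.

(** [e ^+ 2 - p * p] is nonnegative on the interval, and its form at [A] is
    [e^2 |x|^2 - |p(A) x|^2]. *)
Lemma op_horner_nrm a b A p e : bnd dot a b A -> 0 <= e ->
  (forall s, a <= s <= b -> `|p.[s]| <= e) -> forall x, nrm (op_horner p A x) <= e * nrm x.
Proof.
move=> hA e0 pe x; have [sA _] := hA; have lA := self_adjoint_real_linear Hdot sA.
rewrite -ler_sqr ?nnegrE ?mulr_ge0 ?nrm_ge0 // exprMn !(nrm_sq Hdot).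
have : forall s, a <= s <= b -> 0 <= ((e ^+ 2)%:P - p * p).[s].
  move=> s /pe hs; rewrite !hornerE; move: hs; rewrite ler_norml; nra.
move/(op_horner_ge0 hA)/(_ x); rewrite op_hornerB op_hornerC rdotDl rdotNl rdotZl.
by rewrite op_hornerM // (self_adjoint_rdot (self_adjoint_horner p sA)) subr_ge0.
Qed.


Definition poly_approx a b f :=
  forall e, 0 < e -> exists p, forall s, a <= s <= b -> `|p.[s] - f s| <= e.

(* [F] is [f(A)]: any polynomial [e]-close to [f] on [[a, b]] is [e]-close to [F] at [A]. *)
Definition fcalc a b f A F := forall e p,
  (forall s, a <= s <= b -> `|p.[s] - f s| <= e) ->
  forall x, nrm (op_horner p A x - F x) <= e * nrm x.

(** [fcalc] speaks of every polynomial, but one good approximant per precision suffices: polynomials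
    close to [f] are close to each other on the interval, hence at [A]. *)
Lemma fcalc_intro a b f A F : bnd dot a b A ->
  (forall d, 0 < d -> exists2 q, (forall s, a <= s <= b -> `|q.[s] - f s| <= d) &
     forall x, nrm (op_horner q A x - F x) <= d * nrm x) -> fcalc a b f A F.
Proof.
move=> hA h e p pe x; apply/ler_addgt0Pl => c c0.
have n0 : 0 < 2 * (nrm x + 1) by have := nrm_ge0 x; lra.
have [|q qf qF] := h (c / (2 * (nrm x + 1))); first exact: divr_gt0.
set d := c / _ in qf qF.
have dx : 2 * d * nrm x <= c.
  have dE : d * (2 * (nrm x + 1)) = c by rewrite /d divfK // gt_eqF.
  have d0 : 0 < d by rewrite divr_gt0.
  have := nrm_ge0 x; nra.
apply: (le_trans (nrmB _ (op_horner q A x) _)).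
have -> : op_horner p A x - op_horner q A x = op_horner (p - q) A x.
  by rewrite op_hornerB.
have := qF x; have [ab|ab] := boolP (a <= b); last first.
  by rewrite !(bnd_nrm0 _ hA ab) !mulr0 !addr0 => _; exact: ltW.
have : nrm (op_horner (p - q) A x) <= (e + d) * nrm x.
  apply: (op_horner_nrm hA) => [|s hs].
    have := pe a; have := qf a; rewrite lexx ab => /(_ isT) h1 /(_ isT) h2.
    by rewrite addr_ge0 // (le_trans _ h1, le_trans _ h2).
  rewrite hornerD hornerN (_ : _ - _ = (p.[s] - f s) - (q.[s] - f s)); last by ring.
  by rewrite (le_trans (ler_normB _ _)) // lerD ?pe ?qf.
lra.
Qed.

Lemma fcalc_uniq a b f A F G : bnd dot a b A -> poly_approx a b f ->
  fcalc a b f A F -> fcalc a b f A G -> F = G.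
Proof.
move=> hA hf hF hG; apply/funext => x; apply/eqP; rewrite -subr_eq0; apply/eqP.
apply: (@nrm_small _ _ _ (2 * nrm x)) => e e0; have [p hp] := hf e e0.
have := hF e p hp x; have := hG e p hp x; have := nrmB (F x) (op_horner p A x) (G x).
by rewrite (nrmBC (F x) (op_horner p A x)); lra.
Qed.

Lemma fcalc_sub a b a' b' f A F : bnd dot a' b' A -> a <= a' -> b' <= b ->
  poly_approx a b f -> fcalc a b f A F -> fcalc a' b' f A F.
Proof.
move=> hA aa bb hf hF; apply: fcalc_intro => // d d0; have [q hq] := hf d d0.
exists q => [s /andP[h1 h2]|]; last exact: hF.
by apply: hq; rewrite (le_trans aa) // (le_trans h2).
Qed.

Lemma bnd_meet a b a' b' A : bnd dot a b A -> bnd dot a' b' A ->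
  bnd dot (Num.max a a') (Num.min b b') A.
Proof.
by move=> [sA h] [_ h']; split=> // x; case: (leP a a'); case: (leP b b') => _ _;
  case/andP: (h x) => h1 h2; case/andP: (h' x) => h3 h4; apply/andP.
Qed.

Lemma uniform_cvg_itvP a b (p : nat -> {poly R}) f :
  {uniform `[a, b], (fun n => horner (p n)) @ \oo --> f} <->
  forall e, 0 < e -> \forall n \near \oo, forall s, a <= s <= b -> `|(p n).[s] - f s| <= e.
Proof.
split=> h.
  move=> e e0; apply: (h [set g | forall s, a <= s <= b -> `|g s - f s| <= e]).
  apply/uniform_nbhs; exists [set xy | ball xy.1 e xy.2].
  split; first exact: (entourage_ball _ (PosNum e0)).
  move=> g hg s hs; rewrite distrC ltW //; apply: (hg s).
  by rewrite /= in_itv.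
move=> P /uniform_nbhs[E [entE hE]].
have [e /= e0 he] : exists2 e : R, 0 < e & [set xy | ball xy.1 e xy.2] `<=` E.
  by move: entE; rewrite -entourage_ballE => -[e e0 he]; exists e.
have e20 : 0 < e / 2 by lra.
apply: filterS (h _ e20) => n hn; apply: hE => s; rewrite /= in_itv /= => hs; apply: he.
by rewrite /= /ball /= distrC; apply: (le_lt_trans (hn s hs)); lra.
Qed.

Lemma op_cvgP (Y : nat -> H -> H) F : op_cvg Y F <->
  forall e, 0 < e -> \forall n \near \oo, forall x, nrm (Y n x - F x) <= e * nrm x.
Proof.
by split=> h e e0; apply: filterS (h e e0) => n hn x; have := hn x;
  rewrite !normE -rmorphM lecR.
Qed.

Lemma is_fun_calcP f A F : is_fun_calc dot f A F -> exists a b,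
  [/\ bnd dot a b A, poly_approx a b f & fcalc a b f A F].
Proof.
move=> [a [b [p [hA /uniform_cvg_itvP hf /op_cvgP hF]]]]; exists a, b.
have {}hA : bnd dot a b A by exact/betweenP.
split=> //.
  by move=> e e0; have /filter_ex[n hn] := hf e e0; exists (p n).
apply: fcalc_intro => // d d0.
have [n1 _ h1] := hf d d0; have [n2 _ h2] := hF d d0; exists (p (maxn n1 n2)).
  exact: (h1 _ (leq_maxl _ _)).
exact: (h2 _ (leq_maxr _ _)).
Qed.

(** [xget] may return an operator built on another interval. It and [F] both restrict to the
    intersection of the two intervals, where uniqueness identifies them. *)
Lemma fun_calcE a b f A F : bnd dot a b A -> poly_approx a b f ->
  fcalc a b f A F -> fun_calc dot f A = F.
Proof.
move=> hA hf hF; have iF : is_fun_calc dot f A F.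
  have /choice[p hp] : forall n : nat, exists p : {poly R},
      forall s, a <= s <= b -> `|p.[s] - f s| <= n.+1%:R^-1.
    by move=> n; apply: hf; rewrite invr_gt0 ltr0n.
  have near (P : R -> {poly R} -> Prop) : (forall d, 0 < d -> (forall e p, e <= d -> 
    (forall s, a <= s <= b -> `|p.[s] - f s| <= e) -> P d p)) -> 
    forall d, 0 < d -> \forall n \near \oo, P d (p n).
    move=> hP d d0; have [n0 hn] := inv_nat_small d0.
    exists n0 => // n /= /hn hd; exact: (hP d d0 _ _ hd (hp n)).
  exists a, b, p; split; first exact/betweenP.
    apply/uniform_cvg_itvP.
    apply: (near (fun d q => forall s, a <= s <= b -> `|q.[s] - f s| <= d)) => d d0 e q ed hq s hs.
    exact: le_trans (hq s hs) ed.
  apply/op_cvgP; apply: (near (fun d q => forall x, nrm (op_horner q A x - F x) <= d * nrm x)).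
  move=> d d0 e q ed hq x; apply: (le_trans (hF e q hq x)).
  by rewrite ler_wpM2r // nrm_ge0.
have : is_fun_calc dot f A (fun_calc dot f A) by exact: xgetI iF.
move/is_fun_calcP => [a' [b' [hA' hf' hX]]].
have hm := bnd_meet hA hA'.
have m1 : a <= Num.max a a' by rewrite le_max lexx.
have m2 : a' <= Num.max a a' by rewrite le_max lexx orbT.
have m3 : Num.min b b' <= b by rewrite ge_min lexx.
have m4 : Num.min b b' <= b' by rewrite ge_min lexx orbT.
apply: (fcalc_uniq hm); last exact: (fcalc_sub hm m1 m3 hf hF).
  move=> e /hf[p hp]; exists p => s /andP[h1 h2].
  by apply: hp; rewrite (le_trans m1) // (le_trans h2).
exact: (fcalc_sub hm m2 m4 hf' hX).
Qed.

(** The values at [A] of approximants within [1 / (n + 1)] are Cauchy at each vector, at a rate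
    proportional to its norm. Completeness of [H] gives a pointwise limit, and the rate makes the
    convergence uniform. *)
Lemma fcalc_exists a b f A : bnd dot a b A -> poly_approx a b f ->
  exists F, fcalc a b f A F.
Proof.
move=> hA hf.
have /choice[p hp] : forall n : nat, exists p : {poly R},
    forall s, a <= s <= b -> `|p.[s] - f s| <= n.+1%:R^-1.
  by move=> n; apply: hf; rewrite invr_gt0 ltr0n.
pose u x n := op_horner (p n) A x.
have hu x n k : nrm (u x n - u x k) <= (n.+1%:R^-1 + k.+1%:R^-1) * nrm x.
  rewrite /u -op_hornerB; apply: (op_horner_nrm hA) => [|s hs].
    by rewrite addr_ge0 // invr_ge0 ler0n.
  rewrite hornerD hornerN (_ : _ - _ = ((p n).[s] - f s) - ((p k).[s] - f s)); last by ring.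
  by rewrite (le_trans (ler_normB _ _)) // lerD ?hp.
have cu x : cvg (u x @ \oo).
  apply: cauchy_cvg; apply/cauchyP => e e0.
  have [r r0 er] : exists2 r : R, 0 < r & e = r%:C%C.
    exists (complex.Re e); first by move: e0; rewrite ltcE => /andP[].
    by rewrite RRe_real // gtr0_real.
  have d0 : 0 < r / (4 * (nrm x + 1)) by have := nrm_ge0 x => ?; apply: divr_gt0 => //; lra.
  have [n0 hn] := inv_nat_small d0; exists (u x n0).
  exists n0 => // k /= /hn hk; rewrite -ball_normE /= er normE ltcR.
  apply: (le_lt_trans (hu x n0 k)); have h0 := hn n0 (leqnn _); set d := r / _ in d0 hk h0.
  have dE : d * (4 * (nrm x + 1)) = r by rewrite /d divfK // gt_eqF //; have := nrm_ge0 x; lra.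
  have x0 := nrm_ge0 x; have : (n0.+1%:R^-1 + k.+1%:R^-1) * nrm x <= (d + d) * nrm x.
    by rewrite ler_wpM2r // lerD.
  by move/le_lt_trans; apply; rewrite -dE; clearbody d; nra.
exists (fun x => lim (u x @ \oo)); apply: fcalc_intro => // d d0.
have d30 : 0 < d / 3 by lra.
have [n hn] := inv_nat_small d30; have hnn := hn n (leqnn n).
exists (p n) => [s hs|x]; first by rewrite (le_trans (hp n s hs)) // (le_trans hnn) //; lra.
apply/ler_addgt0Pl => c c0; have := cu x => /cvgrPdist_lt /(_ c%:C%C).
rewrite ltcR => /(_ c0) [k0 _ hk]; pose k := maxn n k0.
have := hk k (leq_maxr _ _); rewrite /= normE ltcR => hc; rewrite nrmBC in hc.
have hkn := hn k (leq_maxl _ _).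
have := nrmB (u x n) (u x k) (lim (u x @ \oo)); have := hu x n k.
have x0 := nrm_ge0 x; have : (n.+1%:R^-1 + k.+1%:R^-1) * nrm x <= (d / 3 + d / 3) * nrm x.
  by rewrite ler_wpM2r // lerD.
have := mulr_ge0 (ltW d0) x0; rewrite -/(u x n).
move: (n.+1%:R^-1 + _) => w; move: (nrm (u x n - u x k)) => v.
by move: (w * nrm x) => w'; nra.
Qed.

End SpectralBounds.

Section FunctionalCalculus.
Variables (R : realType) (H : completeNormedModType R[i]).
Variable dot : {dot H for Num.conj}.
Hypothesis Hdot : norm_induced_by dot.
Implicit Types (x y : H) (Z : H -> H) (p q : {poly R}) (e s : R).
Local Notation nrm := (@nrm R H).
Variables (a b : R) (A : H -> H).
Hypothesis hA : bnd dot a b A.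

Let sA : self_adjoint dot A := hA.1.
Let lA := self_adjoint_real_linear Hdot sA.

Lemma fcalc_commute f F Z c x : poly_approx a b f -> fcalc a b f A F ->
  real_linear Z -> (forall y, nrm (Z y) <= c * nrm y) ->
  (forall y, Z (A y) = A (Z y)) -> Z (F x) = F (Z x).
Proof.
move=> hf hF lZ bZ cZ; apply/eqP; rewrite -subr_eq0; apply/eqP.
apply: (@nrm_small _ _ _ (2 * c * nrm x)) => e e0; have [p hp] := hf e e0.
have -> : Z (F x) - F (Z x) = - Z (op_horner p A x - F x) + (op_horner p A (Z x) - F (Z x)).
  by rewrite (real_linearB _ _ lZ) opprB -(op_horner_commute _ _ lZ cZ) addrA subrK.
have h1 : nrm (op_horner p A x - F x) <= e * nrm x by exact: hF.
have h2 : nrm (op_horner p A (Z x) - F (Z x)) <= e * nrm (Z x) by exact: hF.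
apply: (le_trans (nrmD _ _)); rewrite nrmN.
apply: (le_trans (lerD (bZ _) h2)).
(* The bound on [Z] yields [0 <= c] only through a nonzero vector, so [x = 0] is treated apart. *)
have x0 := nrm_ge0 x; have [x00|xn0] := eqVneq (nrm x) 0.
  by rewrite (nrm_eq0 x00) (real_linear0 lZ) (_ : _ - _ = 0) ?nrm0 ?mulr0 ?addr0 //;
    apply: nrm_eq0; apply/eqP; rewrite eq_le nrm_ge0 andbT (le_trans (hF e p hp 0)) // nrm0 mulr0.
have c0 : 0 <= c.
  by rewrite -(pmulr_lge0 _ (_ : 0 < nrm x)) ?(le_trans (nrm_ge0 _) (bZ x)) // lt0r xn0.
have := ler_wpM2l c0 h1; have := ler_wpM2l (ltW e0) (bZ x); lra.
Qed.

(** Symmetry for [rdot] survives the limit; multiplication by ['i], being real linear, isometric and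
    commuting with [A], commutes with [F]. *)
Lemma fcalc_self_adjoint f F : poly_approx a b f -> fcalc a b f A F -> self_adjoint dot F.
Proof.
move=> hf hF; apply: self_adjointP => [x y|x].
  apply/eqP; rewrite -subr_eq0 -normr_eq0; apply/eqP.
  apply: (@small_eq0 _ _ (2 * (nrm x * nrm y))) => // e e0; have [p hp] := hf e e0.
  have sp := self_adjoint_rdot (self_adjoint_horner p sA) x y.
  have -> : rdot dot (F x) y - rdot dot x (F y) =
    rdot dot x (op_horner p A y - F y) - rdot dot (op_horner p A x - F x) y.
    by rewrite rdotDl rdotDr rdotNl rdotNr sp; ring.
  apply: (le_trans (ler_normB _ _)).
  have := abs_rdot_le Hdot x (op_horner p A y - F y).
  have := abs_rdot_le Hdot (op_horner p A x - F x) y.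
  have := ler_wpM2l (nrm_ge0 x) (hF e p hp y); have := ler_wpM2r (nrm_ge0 y) (hF e p hp x).
  lra.
apply/esym; apply: (@fcalc_commute f F (fun x => 'i%C *: x) 1) => // [|y|y].
- by split=> [y z|c y]; rewrite ?scalerDr // !scalerA mulrC.
- by rewrite nrmi mul1r.
- by rewrite (self_adjoint_i Hdot).
Qed.

(** If [q] is [d]-close to [f], then [q - p + d] is nonnegative on the interval; the resulting error
    [2 d |x|^2] is kept below [c]. *)
Lemma fcalc_ge p f F x : poly_approx a b f -> fcalc a b f A F ->
  (forall s, a <= s <= b -> p.[s] <= f s) -> rdot dot (op_horner p A x) x <= rdot dot (F x) x.
Proof.
move=> hf hF pf; rewrite -subr_le0; apply/ler_addgt0Pl => c c0; rewrite addr0.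
have n0 : 0 < 2 * (rdot dot x x + 1) by have := rdot_ge0 Hdot x; lra.
have d0 : 0 < c / (2 * (rdot dot x x + 1)) by exact: divr_gt0.
set d := c / _ in d0; have dE : d * (2 * (rdot dot x x + 1)) = c by rewrite /d divfK // gt_eqF.
have [q hq] := hf d d0.
have := op_horner_ge0 Hdot (p := q - p + d%:P) hA _ x.
have hs s : a <= s <= b -> 0 <= (q - p + d%:P).[s].
  by move=> h; have := hq s h; have := pf s h; rewrite !hornerE ler_norml; lra.
move/(_ hs); rewrite op_hornerD op_hornerB op_hornerC !rdotDl rdotNl rdotZl.
have := abs_rdot_le Hdot (op_horner q A x - F x) x.
have := ler_wpM2r (nrm_ge0 x) (hF d q hq x).
rewrite -mulrA -expr2 (nrm_sq Hdot) rdotDl rdotNl ler_norml -dE.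
move: (nrm _ * nrm _) => w h1 /andP[_ h2]; have := rdot_ge0 Hdot x.
by clearbody d; nra.
Qed.

Lemma fcalcN f F : fcalc a b f A F -> fcalc a b (fun s => - f s) A (fun x => - F x).
Proof.
move=> hF e p hp x; have := hF e (- p) _ x; rewrite op_hornerN -nrmN opprD !opprK; apply.
by move=> s hs; have := hp s hs; rewrite hornerN opprK -normrN opprD.
Qed.

Lemma poly_approxN f : poly_approx a b f -> poly_approx a b (fun s => - f s).
Proof.
move=> hf e e0; have [p hp] := hf e e0; exists (- p) => s hs.
by rewrite hornerN -normrN opprD !opprK hp.
Qed.

Lemma fcalc_le p f F x : poly_approx a b f -> fcalc a b f A F ->
  (forall s, a <= s <= b -> f s <= p.[s]) -> rdot dot (F x) x <= rdot dot (op_horner p A x) x.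
Proof.
move=> hf hF pf; rewrite -lerN2 -!rdotNl -op_hornerN.
apply: (fcalc_ge _ (poly_approxN hf) (fcalcN hF)) => s /pf hs.
by rewrite hornerN lerN2.
Qed.

(** Products that are polynomials suffice: the uses are [s^(1/2) s^(1/2) = s] and
    [s^t s^(-t) = 1]. *)
Lemma fcalc_mul f g F G r C x : poly_approx a b f -> poly_approx a b g ->
  fcalc a b f A F -> fcalc a b g A G -> 0 <= C ->
  (forall s, a <= s <= b -> [/\ `|f s| <= C, `|g s| <= C & f s * g s = r.[s]]) ->
  F (G x) = op_horner r A x.
Proof.
move=> hf hg hF hG C0 hr; apply/eqP; rewrite -subr_eq0; apply/eqP.
(* [4 C + 4 = (C + 2) + (C + 1) + (2 C + 1)]: the errors of [p(A)] at [G x], of [q(A) x] seen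
   through [p(A)], and of [p q] against [r]. The cap [e <= 1] keeps [p] and [q] below [C + 1]. *)
apply: (@nrm_small _ _ _ ((4 * C + 4) * nrm x)) => e' e'0.
have [e [e0 e1 ee]] : exists e, [/\ 0 < e, e <= 1 & e <= e'].
  by exists (Num.min e' 1); rewrite lt_min e'0 ltr01 !ge_min !lexx orbT.
have x0 := nrm_ge0 x.
apply: (@le_trans _ _ (e * ((4 * C + 4) * nrm x))); last first.
  by rewrite ler_wpM2r // mulr_ge0 //; lra.
have [p hp] := hf e e0; have [q hq] := hg e e0.
have pC s : a <= s <= b -> `|p.[s]| <= C + 1.
  move=> hs; have [h1 _ _] := hr s hs; rewrite -(subrK (f s) p.[s]).
  by rewrite (le_trans (ler_normD _ _)) //; have := hp s hs; lra.
have qC s : a <= s <= b -> `|q.[s]| <= C + 1.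
  move=> hs; have [_ h1 _] := hr s hs; rewrite -(subrK (g s) q.[s]).
  by rewrite (le_trans (ler_normD _ _)) //; have := hq s hs; lra.
have C10 : 0 <= C + 1 by lra.
have np y : nrm (op_horner p A y) <= (C + 1) * nrm y by exact: (op_horner_nrm Hdot hA).
have nq y : nrm (op_horner q A y) <= (C + 1) * nrm y by exact: (op_horner_nrm Hdot hA).
have npq : nrm (op_horner (p * q - r) A x) <= (e * (2 * C + 1)) * nrm x.
  apply: (op_horner_nrm Hdot hA) => [|s hs]; first by rewrite mulr_ge0 //; lra.
  have [h1 h2 h3] := hr s hs; rewrite !hornerE -h3.
  have -> : p.[s] * q.[s] - f s * g s = p.[s] * (q.[s] - g s) + (p.[s] - f s) * g s by ring.
  rewrite (le_trans (ler_normD _ _)) // !normrM.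
  have := ler_pM (normr_ge0 _) (normr_ge0 _) (pC s hs) (hq s hs).
  by have := ler_pM (normr_ge0 _) (normr_ge0 _) (hp s hs) h2; lra.
have h1 := hG e q hq x; have h2 := hF e p hp (G x).
have h3 : nrm (G x) <= (C + 2) * nrm x.
  have := nrmD (op_horner q A x) (G x - op_horner q A x); rewrite addrC subrK nrmBC.
  have := nq x; nra.
have -> : F (G x) - op_horner r A x = - (op_horner p A (G x) - F (G x)) +
   (- op_horner p A (op_horner q A x - G x) + op_horner (p * q - r) A x).
  rewrite (real_linearB _ _ (real_linear_horner p lA)) op_hornerB op_hornerM // !opprB.
  by rewrite !addrA !subrK.
apply: (le_trans (nrmD _ _)); rewrite nrmN.
have := nrmD (- op_horner p A (op_horner q A x - G x)) (op_horner (p * q - r) A x).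
rewrite nrmN; have := np (op_horner q A x - G x).
have := ler_wpM2l (ltW e0) h3; have := ler_wpM2l C10 h1.
lra.
Qed.

End FunctionalCalculus.

(** * Polynomial approximation and real powers *)

Section Bernstein.
Variable R : realType.
Implicit Types (g h : nat -> R) (f : R -> R) (x c e s u : R).

(* The expectation of [g] under the binomial law of parameters [n] and ['X]. *)
Fixpoint bernstein n g : {poly R} :=
  if n is k.+1 then 'X * bernstein k (g \o S) + (1 - 'X) * bernstein k g else (g 0%N)%:P.

Lemma bernstein_le n g h x : 0 <= x <= 1 -> (forall k, (k <= n)%N -> g k <= h k) ->
  (bernstein n g).[x] <= (bernstein n h).[x].
Proof.
move=> /andP[x0 x1]; elim: n g h => [|n IH] g h gh /=; first by rewrite !hornerE gh.
rewrite !hornerE; apply: lerD; apply: ler_wpM2l; rewrite ?subr_ge0 //; apply: IH => k hk.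
  exact: gh.
by apply: gh; rewrite leqW.
Qed.

(** The second moment about [c] of the binomial law is its variance plus the squared bias. The
    recursion conditions on one trial, a success shifting [c] to [c - 1]. *)
Lemma bernstein_quadratic n x c0 c1 c :
  (bernstein n (fun k => c0 + c1 * (k%:R - c) ^+ 2)).[x] =
  c0 + c1 * (n%:R * x * (1 - x) + (n%:R * x - c) ^+ 2).
Proof.
elim: n c => [|n IH] c /=; first by rewrite hornerC; ring.
have -> : (fun k => c0 + c1 * (k%:R - c) ^+ 2) \o S = fun k => c0 + c1 * (k%:R - (c - 1)) ^+ 2.
  by apply/funext => k /=; rewrite -natr1; ring.
by rewrite !hornerE !IH -natr1; ring.
Qed.

Lemma lipschitz_approx01 f (L e : R) : 0 < L -> 0 < e ->
  (forall s u, 0 <= s <= 1 -> 0 <= u <= 1 -> `|f s - f u| <= L * `|s - u|) ->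
  exists p : {poly R}, forall s, 0 <= s <= 1 -> `|p.[s] - f s| <= e.
Proof.
move=> L0 e0 hf; have [|n hn] := @inv_nat_small _ ((e / L) ^+ 2).
  by rewrite exprn_gt0 // divr_gt0.
have {hn} := hn n (leqnn n); set N : R := n.+1%:R => hN.
have N0 : 0 < N by rewrite ltr0n.
exists (bernstein n.+1 (fun k => f (k%:R / N))) => x x01.
(* With [h = k / N - x], the bound [L |h| <= e / 2 + L^2 h^2 / (2 e)] reads [e / 2 + w (k - N x)^2];
   the last term has expectation at most [e / 2] because [1 / N <= (e / L)^2]. *)
pose w : R := L ^+ 2 / (2 * e * N ^+ 2).
have w0 : 0 < w by rewrite divr_gt0 ?exprn_gt0 // mulr_gt0 ?exprn_gt0 //; lra.
have key k : (k <= n.+1)%N ->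
    `|f (k%:R / N) - f x| <= e / 2 + w * (k%:R - N * x) ^+ 2.
  move=> hk; apply: (le_trans (hf _ _ _ x01)).
    by rewrite divr_ge0 ?ler0n //= ler_pdivrMr // mul1r ler_nat.
  have -> : w * (k%:R - N * x) ^+ 2 = (L * `|k%:R / N - x|) ^+ 2 / (2 * e).
    rewrite exprMn real_normK ?num_real // /w; field.
    by rewrite !gt_eqF.
  set v := L * _; rewrite -(ler_pM2r (_ : 0 < 2 * e)); last by lra.
  have -> : (e / 2 + v ^+ 2 / (2 * e)) * (2 * e) = e ^+ 2 + v ^+ 2 by field; rewrite gt_eqF.
  by have := sqr_ge0 (v - e); nra.
have tot c : (bernstein n.+1 (fun k => c + w * (k%:R - N * x) ^+ 2)).[x] <= c + e / 2.
  rewrite bernstein_quadratic subrr expr0n addr0 lerD2l -/N.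
  have : x * (1 - x) <= 1 by nra.
  have -> : w * (N * x * (1 - x)) = (L ^+ 2 / (2 * e) * N^-1) * (x * (1 - x)).
    by rewrite /w; field; rewrite !gt_eqF.
  have -> : e / 2 = L ^+ 2 / (2 * e) * (e / L) ^+ 2 by field; rewrite !gt_eqF.
  have h2 : 0 < L ^+ 2 / (2 * e) by rewrite divr_gt0 ?exprn_gt0 //; lra.
  move=> h; rewrite -mulrA ler_pM2l //; apply: le_trans hN.
  by rewrite ler_piMr // invr_ge0 ltW.
rewrite ler_norml; apply/andP; split.
  have h : (bernstein n.+1 (fun k => (f x - e / 2) + - w * (k%:R - N * x) ^+ 2)).[x] <=
           (bernstein n.+1 (fun k => f (k%:R / N))).[x].
    apply: bernstein_le => // k /key; rewrite ler_norml; lra.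
  move: (tot (- (f x - e / 2))) h; rewrite !bernstein_quadratic.
  by move: (_ + _ ^+ 2) => v; move: (_.[x]) => B; nra.
have h : (bernstein n.+1 (fun k => f (k%:R / N))).[x] <=
         (bernstein n.+1 (fun k => (f x + e / 2) + w * (k%:R - N * x) ^+ 2)).[x].
  apply: bernstein_le => // k /key; rewrite ler_norml; lra.
by have := tot (f x + e / 2); lra.
Qed.

Lemma lipschitz_poly_approx (a b L : R) f :
  (forall s u, a <= s <= b -> a <= u <= b -> `|f s - f u| <= L * `|s - u|) ->
  poly_approx a b f.
Proof.
move=> hf e e0; have [ab|ba] := ltP a b; last first.
  exists (f a)%:P => s hs; have -> : s = a by lra.
  by rewrite hornerC subrr normr0 ltW.
have d0 : 0 < b - a by lra.
have aff u : 0 <= u <= 1 -> a <= a + (b - a) * u <= b by nra.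
(* The sign of [L] is unknown and a positive constant is required, hence [|L| + 1]. *)
have [|||p hp] := @lipschitz_approx01 (fun u => f (a + (b - a) * u)) ((`|L| + 1) * (b - a)) e.
- by rewrite mulr_gt0 // ltr_wpDl.
- by [].
- move=> s u hs hu; apply: (le_trans (hf _ _ (aff _ hs) (aff _ hu))).
  rewrite opprD addrACA subrr add0r -mulrBr normrM (gtr0_norm d0) -mulrA.
  by rewrite ler_wpM2r ?mulr_ge0 ?(ltW d0) // (le_trans (ler_norm L)) // lerDl.
exists (p \Po ((b - a)^-1 *: ('X - a%:P))) => s /andP[h1 h2].
rewrite horner_comp !hornerE.
have := hp ((b - a)^-1 * (s - a)); rewrite mulrA divff ?gt_eqF // mul1r (addrC a) subrK; apply.
rewrite mulr_ge0 ?invr_ge0 ?(ltW d0) ?subr_ge0 //= mulrC ler_pdivrMr // mul1r; lra.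
Qed.

End Bernstein.

(** * Scalar inequalities for powers and the generalized Kantorovich constant *)

Section Powers.
Variable R : realType.
Implicit Types (a b s u t p q l : R).

Lemma powR_bounded a b s t : 0 < a -> a <= s <= b -> s `^ t <= a `^ t + b `^ t.
Proof.
move=> a0 /andP[as_ sb]; have s0 : 0 < s by exact: lt_le_trans as_.
have b0 : 0 < b by exact: lt_le_trans sb.
have [t0|t0] := leP 0 t.
  by rewrite (le_trans (ge0_ler_powR t0 _ _ sb)) ?nnegrE ?(ltW s0) ?(ltW b0) // lerDr powR_ge0.
rewrite -[t]opprK !(powRN _ (- t)).
have : (s `^ (- t))^-1 <= (a `^ (- t))^-1.
  by rewrite lef_pV2 ?posrE ?powR_gt0 // ge0_ler_powR ?nnegrE ?(ltW s0) ?(ltW a0) // oppr_ge0 ltW.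
by move/le_trans; apply; rewrite lerDl invr_ge0 powR_ge0.
Qed.

Lemma ln_dist a s u : 0 < a -> a <= s -> a <= u -> `|ln s - ln u| <= `|s - u| / a.
Proof.
move=> a0; wlog su : s u / u <= s => [hw|].
  have [su|su] := leP u s; first exact: hw.
  by rewrite distrC (distrC s) => ? ?; apply: hw => //; exact: ltW.
move=> as_ au; have u0 : 0 < u by exact: lt_le_trans au.
have s0 : 0 < s by exact: lt_le_trans su.
rewrite !ger0_norm ?subr_ge0 ?ler_ln ?posrE //.
have := expR_ge1Dx (ln s - ln u); rewrite expRB !lnK ?posrE // => h.
apply: (@le_trans _ _ (s / u - 1)); first by lra.
have -> : s / u - 1 = (s - u) / u by field; rewrite gt_eqF.
by rewrite ler_wpM2l ?subr_ge0 // lef_pV2 ?posrE.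
Qed.

Lemma powR_expR s t : 0 < s -> s `^ t = expR (t * ln s).
Proof. by move=> s0; rewrite /powR gt_eqF. Qed.

(** Away from [0], [s^t = exp (t ln s)] is Lipschitz: convexity of [exp] controls the outer function
    and [1 / a] the slope of [ln]. *)
Lemma poly_approx_powR a b t : 0 < a -> poly_approx a b (fun s => s `^ t).
Proof.
move=> a0; apply: (@lipschitz_poly_approx _ _ _ ((a `^ t + b `^ t) * `|t| / a)).
have key s u : a <= s <= b -> a <= u <= b ->
    s `^ t - u `^ t <= (a `^ t + b `^ t) * `|t| / a * `|s - u|.
  move=> hs hu; have s0 : 0 < s by case/andP: hs => /(lt_le_trans a0).
  have u0 : 0 < u by case/andP: hu => /(lt_le_trans a0).
  have := powR_bounded t a0 hs; rewrite (powR_expR _ s0) (powR_expR _ u0).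
  set y := t * ln s; set x := t * ln u; set C := _ + _ => hC.
  have C0 : 0 <= C by rewrite (le_trans _ hC) // expR_ge0.
  apply: (@le_trans _ _ (expR y * (y - x))).
    have := expR_ge1Dx (x - y); rewrite expRB; have := expR_gt0 y => y0.
    rewrite ler_pdivlMr // => h; nra.
  apply: (@le_trans _ _ (expR y * `|y - x|)).
    by rewrite ler_wpM2l ?expR_ge0 // ler_norm.
  apply: (@le_trans _ _ (C * `|y - x|)); first by rewrite ler_wpM2r.
  rewrite -!mulrA ler_wpM2l // /x /y -mulrBr normrM ler_wpM2l // mulrC.
  by apply: ln_dist => //; [case/andP: hs|case/andP: hu].
by move=> s u hs hu; rewrite ler_norml lerNl opprB key // (distrC s u) key.
Qed.

(** The tangent to [exp] at [g], the logarithm of the left side, bounds [p] and [q] from below; in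
    the weighted sum the linear terms cancel. *)
Lemma weighted_AMGM p q t : 0 < p -> 0 < q -> 0 <= t <= 1 ->
  p `^ (1 - t) * q `^ t <= (1 - t) * p + t * q.
Proof.
move=> p0 q0 /andP[t0 t1]; rewrite !powR_expR // -expRD; set g := _ + _.
have hp : expR g * (1 + (ln p - g)) <= p.
  have := expR_ge1Dx (ln p - g); rewrite -(ler_pM2l (expR_gt0 g)) -expRD.
  by rewrite (addrC g) subrK lnK.
have hq : expR g * (1 + (ln q - g)) <= q.
  have := expR_ge1Dx (ln q - g); rewrite -(ler_pM2l (expR_gt0 g)) -expRD.
  by rewrite (addrC g) subrK lnK.
have -> : expR g = (1 - t) * (expR g * (1 + (ln p - g))) + t * (expR g * (1 + (ln q - g))).
  have -> : g = (1 - t) * ln p + t * ln q by [].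
  by ring.
by rewrite lerD // ler_wpM2l // subr_ge0.
Qed.

Lemma powR_le_tangent s l t : 0 < s -> 0 < l -> 0 <= t <= 1 ->
  s `^ t <= l `^ t * ((1 - t) + t * (s / l)).
Proof.
move=> s0 l0 t01; have sl : 0 < s / l by rewrite divr_gt0.
have := weighted_AMGM ltr01 sl t01; rewrite powR1 mul1r mulr1.
rewrite -(ler_pM2l (powR_gt0 t l0)) -powRM ?(ltW l0) ?(ltW sl) //.
by rewrite mulrCA divff ?gt_eqF // mulr1.
Qed.

(** The tangent at [s] lies above the graph at both ends, and [s] is their convex combination. *)
Lemma powR_ge_chord a b s t : 0 < a -> a < b -> a <= s <= b -> 0 <= t <= 1 ->
  (b `^ t - a `^ t) / (b - a) * s + (b * a `^ t - a * b `^ t) / (b - a) <= s `^ t.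
Proof.
move=> a0 ab /andP[as_ sb] t01; have s0 : 0 < s by exact: lt_le_trans as_.
have b0 : 0 < b by exact: lt_le_trans sb.
have d0 : 0 < b - a by lra.
have ha := powR_le_tangent a0 s0 t01; have hb := powR_le_tangent b0 s0 t01.
have -> : (b `^ t - a `^ t) / (b - a) * s + (b * a `^ t - a * b `^ t) / (b - a) =
   ((s - a) * b `^ t + (b - s) * a `^ t) / (b - a) by field; rewrite gt_eqF.
rewrite ler_pdivrMr //.
have -> : s `^ t * (b - a) = (s - a) * (s `^ t * (1 - t + t * (b / s))) +
    (b - s) * (s `^ t * (1 - t + t * (a / s))) by field; rewrite gt_eqF.
by rewrite lerD // ler_wpM2l // subr_ge0.
Qed.

(** For [0 < t < 1] and [a < b], [c s + d] is the chord, and AM-GM on [(1 - t) (D p) + t (C q)] with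
    [D = d / (1 - t)], [C = c / t] produces the factor [D^(1-t) C^t], which is [K]. For [t] equal to
    [0] or [1] the power is itself affine. *)
Lemma kantorovich_line a b t : 0 < a -> a <= b -> 0 <= t <= 1 -> exists c d,
  [/\ 0 <= c, 0 <= d, 0 < kantorovich a b t,
      forall s, a <= s <= b -> c * s + d <= s `^ t &
      forall p q, 0 < p -> 0 < q ->
        kantorovich a b t * (p `^ (1 - t) * q `^ t) <= d * p + c * q].
Proof.
move=> a0 ab t01; have /andP[t0 t1] := t01.
have b0 : 0 < b by exact: lt_le_trans ab.
rewrite /kantorovich; have [->|tn0] /= := eqVneq t 0.
  exists 0, 1; split=> // [s _|p q p0 q0]; first by rewrite mul0r add0r powRr0.
  by rewrite subr0 powRr0 (powRr1 (ltW p0)) mulr1 mul0r addr0.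
have [->|tn1] /= := eqVneq t 1.
  exists 1, 0; split=> // [s /andP[h _]|p q p0 q0].
    by rewrite mul1r addr0 powRr1 // (le_trans (ltW a0)).
  by rewrite subrr powRr0 (powRr1 (ltW q0)) !mul1r mul0r add0r.
have t0' : 0 < t by rewrite lt0r tn0.
have t1' : 0 < 1 - t by rewrite subr_gt0 lt_neqAle tn1.
have [eab|nab] /= := eqVneq a b.
  (* On a single point the tangent at [a] replaces the chord; [D] and [C] become [a^t] and
     [a^(t-1)], whose weighted product is [1]. *)
  exists (t * (a `^ t / a)), ((1 - t) * a `^ t); split=> //.
  - by rewrite mulr_ge0 // divr_ge0 ?powR_ge0 // ltW.
  - by rewrite mulr_ge0 ?powR_ge0 // ltW.
  - move=> s hs; have -> : s = a by lra.
    by have -> : t * (a `^ t / a) * a + (1 - t) * a `^ t = a `^ t by field; rewrite gt_eqF.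
  move=> p q p0 q0; have A0 := powR_gt0 t a0.
  have := weighted_AMGM (mulr_gt0 A0 p0) (mulr_gt0 (divr_gt0 A0 a0) q0) t01.
  have na : a != 0 by rewrite gt_eqF.
  have -> : a `^ t / a = a `^ (t - 1).
    by rewrite powRD ?na ?implybT // powR_inv1 // ltW.
  rewrite !powRM ?powR_ge0 ?(ltW p0) ?(ltW q0) // mulrACA -!powRrM -powRD ?na ?implybT //.
  have -> : t * (1 - t) + (t - 1) * t = 0 by ring.
  by rewrite powRr0; lra.
have {nab}ab : a < b by rewrite lt_neqAle nab.
have d0 : 0 < b - a by lra.
set c := (b `^ t - a `^ t) / (b - a); set d := (b * a `^ t - a * b `^ t) / (b - a).
have c0 : 0 < c.
  by rewrite divr_gt0 // subr_gt0 gt0_ltr_powR ?nnegrE // ltW.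
(* After division by [a^t b^t] this is [a^(1-t) < b^(1-t)]. *)
have X0 : 0 < b * a `^ t - a * b `^ t.
  rewrite subr_gt0 -[X in X * b `^ t](powRr1 (ltW a0)) -[X in _ < X * _](powRr1 (ltW b0)).
  have sp x : 0 < x -> x `^ 1 = x `^ (1 - t) * x `^ t.
    by move=> x0; rewrite -powRD ?subrK // (gt_eqF x0) implybT.
  rewrite !sp // mulrAC -!mulrA ltr_pM2r; last by rewrite mulr_gt0 ?powR_gt0.
  by rewrite gt0_ltr_powR ?nnegrE // ltW.
have e0 : 0 < d by rewrite divr_gt0.
(* Both [t - 1] and [a b^t - b a^t] are negative here; flipping their signs exposes
   [D (C / D)^t]. *)
rewrite -[t - 1]opprB -[a * b `^ t - _]opprB; set X := b * a `^ t - _ in d X0 e0 *.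
set T := 1 - t in t1' *.
have -> : - X / (- T * (b - a)) = d / T by rewrite /d; field; rewrite !gt_eqF.
have -> : - T / t * ((b `^ t - a `^ t) / - X) = (c / t) / (d / T).
  by rewrite /c /d; field; rewrite !gt_eqF.
exists c, d; split; try exact: ltW.
- by apply: mulr_gt0; [|apply: powR_gt0; apply: divr_gt0]; apply: divr_gt0.
- by move=> s hs; exact: powR_ge_chord.
move=> p q p0 q0; set D := d / _; set C := c / _.
have D0 : 0 < D by rewrite divr_gt0.
have C0 : 0 < C by rewrite divr_gt0.
have -> : D * (C / D) `^ t = D `^ (1 - t) * C `^ t.
  rewrite powRM ?invr_ge0 ?ltW // -(powR_inv1 (ltW D0)) -powRrM mulN1r mulrCA mulrC.
  rewrite -{1}(powRr1 (ltW D0)) -powRD //; by rewrite (gt_eqF D0) implybT.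
rewrite mulrACA -!powRM ?(ltW D0) ?(ltW C0) ?(ltW p0) ?(ltW q0) //.
have := weighted_AMGM (mulr_gt0 D0 p0) (mulr_gt0 C0 q0) t01.
have -> : (1 - t) * (D * p) = d * p by rewrite mulrA -/T (mulrC T) divfK ?gt_eqF.
by have -> : t * (C * q) = c * q by rewrite mulrA (mulrC t) divfK ?gt_eqF.
Qed.

End Powers.

(** * Operator inequalities and operator powers *)

Section OperatorOrder.
Variables (R : realType) (H : completeNormedModType R[i]).
Variable dot : {dot H for Num.conj}.
Hypothesis Hdot : norm_induced_by dot.
Implicit Types (x y v : H) (A B G P Q : H -> H) (a b c d t : R).
Local Notation nrm := (@nrm R H).
Local Notation rd := (rdot dot).

Lemma bnd_op_nrm a b A x : 0 <= a -> 0 <= b -> bnd dot a b A -> nrm (A x) <= b * nrm x.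
Proof.
move=> a0 b0 hA; rewrite -op_hornerX; apply: (op_horner_nrm Hdot hA) => // s hs.
by rewrite hornerX ler_norml; lra.
Qed.

Lemma bnd_sq_le a b A x : bnd dot a b A ->
  rd (A x) (A x) + a * b * rd x x <= (a + b) * rd (A x) x.
Proof.
move=> hA; have lA := self_adjoint_real_linear Hdot hA.1.
have h s : a <= s <= b -> 0 <= (('X - a%:P) * (b%:P - 'X)).[s].
  by move=> hs; rewrite !hornerE; nra.
have := op_horner_ge0 Hdot hA h x.
rewrite op_hornerM // !op_hornerB !op_hornerX !op_hornerC (real_linearB _ _ lA) lA.2.
rewrite !(rdotDl, rdotDr, rdotNl, rdotNr, rdotZl, rdotZr, scalerDr, scalerN).
rewrite (self_adjoint_rdot hA.1 (A x)); lra.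
Qed.

Lemma bnd_sq_ge a b A x : 0 <= a -> bnd dot a b A -> a * rd (A x) x <= rd (A x) (A x).
Proof.
move=> a0 hA; have lA := self_adjoint_real_linear Hdot hA.1.
have h s : a <= s <= b -> 0 <= ('X * ('X - a%:P)).[s].
  by move=> hs; rewrite !hornerE; nra.
have := op_horner_ge0 Hdot hA h x.
rewrite op_hornerXM // !op_hornerB !op_hornerX !op_hornerC (real_linearB _ _ lA) lA.2.
rewrite !(rdotDl, rdotNl, rdotZl) (self_adjoint_rdot hA.1 (A x)); lra.
Qed.

(** Multiply the form of [(A - m) (M - A) >= 0] by [|x|^2]; the gap to the claimed bound is the
    square displayed in [e]. *)
Lemma bnd_kantorovich m M A x : 0 < m -> m <= M -> bnd dot m M A ->
  rd (A x) (A x) * rd x x <= (M + m) ^+ 2 / (4 * M * m) * rd (A x) x ^+ 2.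
Proof.
move=> m0 mM hA; have := bnd_sq_le x hA; have := rdot_ge0 Hdot x.
move: (rd (A x) (A x)) (rd (A x) x) (rd x x) => P p n n0 h.
have M0 : 0 < M by exact: lt_le_trans mM.
have e : (M + m) ^+ 2 / (4 * M * m) * p ^+ 2 =
   (M + m) * p * n - m * M * n ^+ 2 + ((M + m) * p - 2 * (M * m) * n) ^+ 2 / (4 * M * m).
  by field; rewrite !gt_eqF.
have h2 : 0 <= ((M + m) * p - 2 * (M * m) * n) ^+ 2 / (4 * M * m).
  by rewrite divr_ge0 ?sqr_ge0 // !mulr_ge0 // ltW.
have h3 := ler_wpM2r n0 h.
rewrite e; apply: (@le_trans _ _ ((M + m) * p * n - m * M * n ^+ 2)); last by rewrite lerDl.
by move: h3; rewrite !mulrDl expr2; lra.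
Qed.

(* If [mu > 0] is optimal with [Q - P >= - mu], then at an almost minimising [x] one
   has [(Q - P) x ~ - mu x], so [|Q x|^2 - |P x|^2 = <(Q - P) x, (Q + P) x>] would be
   negative. *)
Lemma sqrt_monotone c d P Q : 0 < c -> c <= d -> bnd dot c d P -> bnd dot c d Q ->
  (forall x, rd (P x) (P x) <= rd (Q x) (Q x)) -> forall x, rd (P x) x <= rd (Q x) x.
Proof.
move=> c0 cd hP hQ PQ; pose E x := Q x - P x.
have d0 : 0 < d by exact: lt_le_trans cd.
have sE : self_adjoint dot E := self_adjointB hQ.1 hP.1.
pose S := [set mu : R | 0 <= mu /\ forall x, - mu * rd x x <= rd (E x) x].
have Ele x : rd (E x) x <= d * rd x x.
  rewrite /E rdotDl rdotNl; have /andP[_ h1] := hQ.2 x; have /andP[h2 _] := hP.2 x.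
  have := mulr_ge0 (ltW c0) (rdot_ge0 Hdot x); lra.
have Sd : S d.
  split=> [|x]; first exact: ltW.
  rewrite /E rdotDl rdotNl; have /andP[h1 _] := hQ.2 x; have /andP[_ h2] := hP.2 x.
  have := mulr_ge0 (ltW c0) (rdot_ge0 Hdot x); lra.
have iS : has_inf S by split; [exists d|exists 0 => mu []].
have Smu : S (inf S).
  split; first by apply: lb_le_inf => [|mu []//]; exists d.
  move=> x; apply/ler_addgt0Pl => e e0.
  have e1 : 0 < e / (rd x x + 1) by rewrite divr_gt0 // ltr_wpDl ?(rdot_ge0 Hdot).
  have [mu [mu0 hmu] le] := inf_adherent e1 iS.
  apply: le_trans (_ : e + - mu * rd x x <= _); last by rewrite lerD2l.
  have x0 := rdot_ge0 Hdot x.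
  have : (mu - inf S) * rd x x <= e / (rd x x + 1) * rd x x by rewrite ler_wpM2r //; lra.
  have : e / (rd x x + 1) * rd x x <= e.
    by rewrite mulrAC ler_pdivrMr ?ltr_wpDl // ler_wpM2l ?ltW //; lra.
  lra.
have [mu0 hmu] := Smu; set mu := inf S in mu0 hmu Smu.
suff muE : mu = 0.
  by move=> x; have := hmu x; rewrite muE oppr0 mul0r /E rdotDl rdotNl; lra.
apply/eqP; rewrite eq_le mu0 andbT leNgt; apply/negP => mup.
pose G x := E x + mu%:C%C *: x.
have bG : bnd dot 0 (2 * d) G.
  split=> [y z|x].
    have := self_adjoint_scale mu (self_adjoint_id dot) y z.
    by rewrite /op_scale /= /G linearDl linearDr /= sE => ->.
  rewrite /G rdotDl rdotZl mul0r; have := hmu x; have := Ele x.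
  have : mu <= d by apply: ge_inf iS.2 _ Sd.
  by move/(ler_wpM2r (rdot_ge0 Hdot x)) => h1 h2 h3; apply/andP; split; lra.
(* The chain is [2 c mu |x|^2 <= mu <x, y> <= <G x, y> <= 2 d |G x| |x|], combined with
   [|G x|^2 <= 2 d <G x, x>], which holds as [0 <= G <= 2 d]. *)
have key x : mu ^+ 2 * (2 * c) ^+ 2 * rd x x <= (2 * d) ^+ 3 * rd (G x) x.
  pose y := Q x + P x.
  have h1 : 0 <= rd (E x) y.
    have := PQ x; rewrite /E /y !(rdotDl, rdotDr, rdotNl).
    by rewrite (rdotC dot (P x) (Q x)); lra.
  have h2 : rd (E x) y = rd (G x) y - mu * rd x y by rewrite /G rdotDl rdotZl addrK.
  have h3 : 2 * c * rd x x <= rd x y.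
    rewrite rdotC rdotDl; have /andP[k1 _] := hQ.2 x; have /andP[k2 _] := hP.2 x; lra.
  have h4 : nrm y <= 2 * d * nrm x.
    have := nrmD (Q x) (P x); have := bnd_op_nrm x (ltW c0) (ltW d0) hQ.
    have := bnd_op_nrm x (ltW c0) (ltW d0) hP; rewrite /y; lra.
  have h5 : nrm (G x) ^+ 2 <= 2 * d * rd (G x) x.
    by have := bnd_sq_le x bG; rewrite (nrm_sq Hdot) !mul0r addr0 add0r.
  have h6 := rdot_le Hdot (G x) y.
  have x0 := nrm_ge0 x; have G0 := nrm_ge0 (G x).
  have h7 : mu * (2 * c) * nrm x <= nrm (G x) * (2 * d).
    have [->|xn0] := eqVneq (nrm x) 0; first by rewrite mulr0 mulr_ge0 // mulr_ge0 // ltW.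
    have xp : 0 < nrm x by rewrite lt0r xn0.
    rewrite -(ler_pM2r xp) -[leLHS]mulrA -expr2 (nrm_sq Hdot) -!mulrA.
    have := ler_wpM2l (ltW mup) h3; have := ler_wpM2l G0 h4.
    by rewrite -!mulrA; lra.
  have h8 : (mu * (2 * c) * nrm x) ^+ 2 <= (nrm (G x) * (2 * d)) ^+ 2.
    by rewrite ler_sqr // nnegrE !mulr_ge0 // ltW.
  have -> : mu ^+ 2 * (2 * c) ^+ 2 * rd x x = (mu * (2 * c) * nrm x) ^+ 2.
    by rewrite -(nrm_sq Hdot); ring.
  apply: (le_trans h8).
  have -> : (nrm (G x) * (2 * d)) ^+ 2 = (2 * d) ^+ 2 * nrm (G x) ^+ 2 by ring.
  have -> : (2 * d) ^+ 3 * rd (G x) x = (2 * d) ^+ 2 * (2 * d * rd (G x) x) by ring.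
  by rewrite ler_wpM2l ?sqr_ge0.
(* [G >= th] means that [mu - th], or [0] if this is negative, still belongs to [S], against the
   minimality of [mu]. *)
pose th := mu ^+ 2 * (2 * c) ^+ 2 / (2 * d) ^+ 3.
have th0 : 0 < th by rewrite divr_gt0 ?mulr_gt0 ?exprn_gt0 // mulr_gt0.
have imp x : - (mu - th) * rd x x <= rd (E x) x.
  have D0 : 0 < (2 * d) ^+ 3 by rewrite exprn_gt0 // mulr_gt0.
  have h : th * rd x x <= rd (G x) x.
    rewrite -(ler_pM2l D0); apply: le_trans (key x).
    by rewrite mulrA (mulrC _ th) divfK // gt_eqF.
  by move: h; rewrite /G rdotDl rdotZl; lra.
have [h|h] := leP 0 (mu - th).
  have : mu <= mu - th by apply: ge_inf; [exact: iS.2|split].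
  by lra.
have : mu <= 0; last by lra.
apply: ge_inf; first exact: iS.2.
split=> // x; rewrite oppr0 mul0r; apply: le_trans (imp x).
by rewrite mulr_ge0 ?(rdot_ge0 Hdot) //; lra.
Qed.

End OperatorOrder.

(** * Powers of an operator with positive bounds *)

Section OperatorPowers.
Variables (R : realType) (H : completeNormedModType R[i]).
Variable dot : {dot H for Num.conj}.
Hypothesis Hdot : norm_induced_by dot.
Implicit Types (x y v : H) (A B G P Q : H -> H) (a b c d t : R).
Local Notation nrm := (@nrm R H).
Local Notation rd := (rdot dot).

Lemma op_pow_fcalc a b A t : 0 < a -> bnd dot a b A ->
  fcalc a b (fun s => s `^ t) A (op_pow dot A t).
Proof.
move=> a0 hA; have hf := poly_approx_powR b t a0.
by have [F hF] := fcalc_exists Hdot hA hf; rewrite /op_pow (fun_calcE Hdot hA hf hF).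
Qed.

Lemma op_pow_self_adjoint a b A t : 0 < a -> bnd dot a b A -> self_adjoint dot (op_pow dot A t).
Proof.
move=> a0 hA; apply: (fcalc_self_adjoint Hdot hA (poly_approx_powR b t a0)).
exact: op_pow_fcalc.
Qed.

Lemma op_pow_ge_line a b A t c d x : 0 < a -> bnd dot a b A ->
  (forall s, a <= s <= b -> c * s + d <= s `^ t) ->
  c * rd (A x) x + d * rd x x <= rd (op_pow dot A t x) x.
Proof.
move=> a0 hA h.
have := fcalc_ge Hdot hA (p := c *: 'X + d%:P) x (poly_approx_powR b t a0)
  (op_pow_fcalc (t := t) a0 hA).
rewrite op_hornerD op_hornerZ op_hornerX op_hornerC rdotDl !rdotZl; apply => s /h.
by rewrite !hornerE.
Qed.

Lemma op_pow_le_line a b A t c d x : 0 < a -> bnd dot a b A ->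
  (forall s, a <= s <= b -> s `^ t <= c * s + d) ->
  rd (op_pow dot A t x) x <= c * rd (A x) x + d * rd x x.
Proof.
move=> a0 hA h.
have := fcalc_le Hdot hA (p := c *: 'X + d%:P) x (poly_approx_powR b t a0)
  (op_pow_fcalc (t := t) a0 hA).
rewrite op_hornerD op_hornerZ op_hornerX op_hornerC rdotDl !rdotZl; apply => s /h.
by rewrite !hornerE.
Qed.

Lemma op_pow_bnd a b A t c d : 0 < a -> bnd dot a b A ->
  (forall s, a <= s <= b -> c <= s `^ t <= d) -> bnd dot c d (op_pow dot A t).
Proof.
move=> a0 hA h; split=> [|x]; first exact: op_pow_self_adjoint hA.
apply/andP; split; rewrite -(add0r (_ * rd x x)) -(mul0r (rd (A x) x)).
  by apply: (op_pow_ge_line x a0 hA) => s /h; rewrite mul0r add0r => /andP[].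
by apply: (op_pow_le_line x a0 hA) => s /h; rewrite mul0r add0r => /andP[].
Qed.

Lemma op_pow_bnd_pos a b A t : 0 < a -> bnd dot a b A ->
  exists c d, [/\ 0 < c, c <= d & bnd dot c d (op_pow dot A t)].
Proof.
move=> a0 hA; have h1 s := @powR_bounded R a b s t a0.
have h2 s := @powR_bounded R a b s (- t) a0.
(* The lower bound inverts the upper bound for [s^(-t)]; adding it to the upper bound makes [c <= d]
   immediate without comparing [a] and [b]. *)
exists (a `^ (- t) + b `^ (- t))^-1, (a `^ t + b `^ t + (a `^ (- t) + b `^ (- t))^-1).
have p0 : 0 < a `^ (- t) + b `^ (- t) by rewrite ltr_pwDl ?powR_gt0 ?powR_ge0.
split; first by rewrite invr_gt0.
  by rewrite lerDr addr_ge0 ?powR_ge0.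
apply: (op_pow_bnd a0 hA) => s hs; have s0 : 0 < s by case/andP: hs => /(lt_le_trans a0).
apply/andP; split; last by rewrite (le_trans (h1 _ hs)) // lerDl invr_ge0 ltW.
by rewrite -[s `^ t]invrK lef_pV2 ?posrE ?invr_gt0 ?powR_gt0 // -powRN h2.
Qed.

Lemma op_pow_mul a b A t u (r : {poly R}) x : 0 < a -> bnd dot a b A ->
  (forall s, a <= s <= b -> s `^ t * s `^ u = r.[s]) ->
  op_pow dot A t (op_pow dot A u x) = op_horner r A x.
Proof.
move=> a0 hA hr.
apply: (fcalc_mul Hdot hA (C := a `^ t + b `^ t + (a `^ u + b `^ u)) x
  (poly_approx_powR b t a0) (poly_approx_powR b u a0) (op_pow_fcalc (t := t) a0 hA)
  (op_pow_fcalc (t := u) a0 hA)); first by rewrite !addr_ge0 ?powR_ge0.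
move=> s hs; split; last exact: hr.
  by rewrite ger0_norm ?powR_ge0 // (le_trans (powR_bounded t a0 hs)) // lerDl addr_ge0 ?powR_ge0.
by rewrite ger0_norm ?powR_ge0 // (le_trans (powR_bounded u a0 hs)) // lerDr addr_ge0 ?powR_ge0.
Qed.

Lemma op_sqrt_sqr a b A x : 0 < a -> bnd dot a b A ->
  op_pow dot A (1 / 2) (op_pow dot A (1 / 2) x) = A x.
Proof.
move=> a0 hA; rewrite (op_pow_mul (r := 'X) x a0 hA) ?op_hornerX // => s /andP[h _].
have s0 : 0 < s by exact: lt_le_trans h.
by rewrite hornerX -powRD ?(gt_eqF s0) ?implybT // (_ : _ + _ = 1) ?powRr1 ?ltW //; lra.
Qed.

Lemma op_powK a b A t x : 0 < a -> bnd dot a b A ->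
  op_pow dot A t (op_pow dot A (- t) x) = x.
Proof.
move=> a0 hA; rewrite (op_pow_mul (r := 1%:P) x a0 hA) ?op_hornerC ?scale1r // => s /andP[h _].
have s0 : 0 < s by exact: lt_le_trans h.
by rewrite hornerC powRN divff // gt_eqF // powR_gt0.
Qed.

Lemma op_powNK a b A t x : 0 < a -> bnd dot a b A ->
  op_pow dot A (- t) (op_pow dot A t x) = x.
Proof. by move=> a0 hA; rewrite -{2}[t]opprK (op_powK _ _ a0 hA). Qed.

(* [y := Q x - G x] with [Q := op_pow A (1 / 2)] satisfies [Q y + G y = 0] as [G]
   commutes with [Q]. *)
Lemma op_sqrt_unique a b c d A G : 0 < a -> bnd dot a b A -> 0 < c -> c <= d ->
  bnd dot c d G -> (forall x, G (G x) = A x) -> op_pow dot A (1 / 2) = G.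
Proof.
move=> a0 hA c0 cd hG GG; have d0 : 0 < d by exact: lt_le_trans cd.
have [c' [d' [c'0 _ hQ]]] := op_pow_bnd_pos (1 / 2) a0 hA.
set Q := op_pow dot A (1 / 2) in hQ *.
have lG := self_adjoint_real_linear Hdot hG.1; have lQ := self_adjoint_real_linear Hdot hQ.1.
have com x : G (Q x) = Q (G x).
  apply: (fcalc_commute x (poly_approx_powR b (1 / 2) a0)
    (op_pow_fcalc (t := 1 / 2) a0 hA) lG (c := d)) => y.
    exact: (bnd_op_nrm Hdot y (ltW c0) (ltW d0) hG).
  by rewrite -!GG.
apply/funext => x; apply/eqP; rewrite -subr_eq0; apply/eqP; set y := _ - _.
have y0 : Q y + G y = 0.
  rewrite /y (real_linearB _ _ lQ) (real_linearB _ _ lG) com GG.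
  by rewrite /Q (op_sqrt_sqr _ a0 hA) addrA subrK subrr.
have := rdot0l dot y; rewrite -{1}y0 rdotDl => e.
have /andP[h1 _] := hQ.2 y; have /andP[h2 _] := hG.2 y.
have h3 := rdot_ge0 Hdot y; apply/nrm_eq0/eqP; rewrite -sqrf_eq0 (nrm_sq Hdot).
by rewrite eq_le h3 andbT -(pmulr_rle0 _ (addr_gt0 c0 c'0)); lra.
Qed.

Lemma op_invE A G : cancel A G -> cancel G A -> op_inv A = G.
Proof.
move=> AG GA; have [h _] : cancel A (op_inv A) /\ cancel (op_inv A) A.
  by apply: (@xgetI _ A [set Y | cancel A Y /\ cancel Y A] G).
by apply/funext => x; rewrite -{1}(GA x) h.
Qed.

Lemma bnd_weaken a b c d A : c <= a -> b <= d -> bnd dot a b A -> bnd dot c d A.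
Proof.
move=> ca bd [sA h]; split=> // x; have x0 := rdot_ge0 Hdot x; have /andP[h1 h2] := h x.
by rewrite (le_trans _ h1) ?(le_trans h2) // ler_wpM2r.
Qed.

Lemma self_adjoint_conj A G : self_adjoint dot A -> self_adjoint dot G ->
  self_adjoint dot (G \o A \o G).
Proof. by move=> sA sG x y; rewrite /= sG sA sG. Qed.

Lemma bnd_conj a b c d A G : 0 <= a -> 0 <= b -> bnd dot a b A -> self_adjoint dot G ->
  (forall x, c * rd x x <= rd (G x) (G x) <= d * rd x x) ->
  bnd dot (a * c) (b * d) (G \o A \o G).
Proof.
move=> a0 b0 hA sG hG; split=> [|x]; first exact: self_adjoint_conj hA.1 sG.
rewrite /= (self_adjoint_rdot sG); have /andP[h1 h2] := hA.2 (G x).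
have /andP[h3 h4] := hG x; rewrite -!mulrA.
by rewrite (le_trans _ h1) ?(le_trans h2) // ler_wpM2l.
Qed.

End OperatorPowers.

(** * The geometric means *)

(* Used with [n = |v|^2], [p = <Av, v>], [q = <Tv, v>], [P = |Av|^2], [Q = |Tv|^2],
   [Z = |S C^t x|^2], [w = <C^t x, x>], [U = <D^t A v, A v>] in the notation of the header;
   the tangent to [s^t] is taken at [l = (q / p)^2]. *)
Lemma mean_comparison (R : realType) (K k t n p q P Q Z U w : R) :
  0 <= t <= 1 -> 0 < K -> 0 <= k -> 0 < n -> 0 < p -> 0 < q -> 0 <= Q ->
  P * n <= k * p ^+ 2 -> Q * n <= k * q ^+ 2 ->
  K * (p `^ (1 - t) * q `^ t) <= w -> w ^+ 2 <= Z * n ->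
  (forall l, 0 < l -> U <= l `^ t * ((1 - t) * P + t * (Q / l))) ->
  U <= 1 / K ^+ 2 * k * Z.
Proof.
move=> /andP[t0 t1] K0 k0 n0 p0 q0 Q0 hP hQ hw hZ hU.
pose l := (q / p) ^+ 2; have l0 : 0 < l by rewrite exprn_gt0 // divr_gt0.
set E := _ * q `^ t in hw.
have EE : E ^+ 2 = p ^+ 2 * l `^ t.
  have lnl : ln l = 2 * (ln q - ln p).
    by rewrite /l lnXn ?divr_gt0 // ln_div ?posrE // mulr_natl.
  rewrite /E !powR_expR // -expRD -expRM_natl lnl -[p in p ^+ 2](lnK (_ : p \in Num.pos)) ?posrE //.
  by rewrite -expRM_natl -expRD; congr expR; ring.
have E0 : 0 <= E by rewrite mulr_ge0 // powR_ge0.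
have lt0 := powR_ge0 l t.
have h1 : U * n <= k * E ^+ 2.
  apply: (le_trans (ler_wpM2r (ltW n0) (hU l l0))); rewrite EE.
  have -> : l `^ t * ((1 - t) * P + t * (Q / l)) * n =
     l `^ t * ((1 - t) * (P * n) + t * (Q * n / l)) by ring.
  rewrite (mulrC (p ^+ 2)) [leRHS]mulrCA ler_wpM2l //.
  (* The choice of [l] makes the bounds [k p^2] and [k q^2 / l] coincide, so the weights [1 - t] and
     [t] recombine. *)
  have -> : k * p ^+ 2 = (1 - t) * (k * p ^+ 2) + t * (k * q ^+ 2 / l).
    by rewrite /l; field; rewrite !gt_eqF.
  by rewrite lerD // ler_wpM2l ?subr_ge0 // ler_wpM2r // invr_ge0 ltW.
have h2 : K ^+ 2 * E ^+ 2 <= Z * n.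
  have KE0 : 0 <= K * E by rewrite mulr_ge0 // ltW.
  by apply: le_trans hZ; rewrite -exprMn ler_sqr ?nnegrE // (le_trans KE0 hw).
have K2 : 0 < K ^+ 2 by rewrite exprn_gt0.
rewrite div1r -mulrA mulrC ler_pdivlMr // -(ler_pM2r n0) mulrAC.
apply: (le_trans (ler_wpM2r (ltW K2) h1)).
by rewrite -(mulrA k (E ^+ 2)) -(mulrA k Z) ler_wpM2l // [leLHS]mulrC.
Qed.

Section GeometricMeans.
Variables (R : realType) (H : completeNormedModType R[i]).
Variable dot : {dot H for Num.conj}.
Hypothesis Hdot : norm_induced_by dot.
Variables (A B : H -> H) (m M : R).
Hypotheses (m0 : 0 < m) (mM : m <= M) (hA : bnd dot m M A) (hB : bnd dot m M B).
Implicit Types (x y v : H).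
Local Notation nrm := (@nrm R H).
Local Notation rd := (rdot dot).
Local Notation S := (op_pow dot A (1 / 2)).
Local Notation S' := (op_pow dot A (- (1 / 2))).
Local Notation T := (op_pow dot (S \o B \o S) (1 / 2)).
Local Notation C := (S' \o T \o S').
Local Notation D := (S' \o B \o S').

Let M0 : 0 < M := lt_le_trans m0 mM.
Let sS : self_adjoint dot S := op_pow_self_adjoint Hdot _ m0 hA.
Let sS' : self_adjoint dot S' := op_pow_self_adjoint Hdot _ m0 hA.
Let SS x : S (S x) = A x. Proof. exact: (op_sqrt_sqr Hdot x m0 hA). Qed.
Let SK x : S (S' x) = x. Proof. exact: (op_powK Hdot _ x m0 hA). Qed.
Let SK' x : S' (S x) = x. Proof. exact: (op_powNK Hdot _ x m0 hA). Qed.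

Lemma rdot_sqrt x : rd (S x) (S x) = rd (A x) x.
Proof. by rewrite -(self_adjoint_rdot sS) SS. Qed.

Lemma rdot_inv_sqrt x : M^-1 * rd x x <= rd (S' x) (S' x) <= m^-1 * rd x x.
Proof.
have /andP[h1 h2] := hA.2 (S' x).
have e : rd (A (S' x)) (S' x) = rd x x by rewrite -rdot_sqrt SK.
rewrite e in h1 h2; rewrite mulrC ler_pdivrMr // [X in _ && (_ <= X)]mulrC ler_pdivlMr //.
by rewrite mulrC h2 mulrC h1.
Qed.

Lemma op_inv_sqrt : op_inv A = S' \o S'.
Proof.
apply: op_invE => x /=; first by rewrite -SS !SK'.
by rewrite -SS !SK.
Qed.

Lemma bnd_op_inv : bnd dot M^-1 m^-1 (op_inv A).
Proof.
rewrite op_inv_sqrt; split=> [x y|x]; first by rewrite /= sS' sS'.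
by rewrite /= (self_adjoint_rdot sS') rdot_inv_sqrt.
Qed.

(** [geom_mean] takes powers of [op_inv A], a separate calculus; uniqueness of the positive square
    root brings it back to powers of [A]. *)
Lemma op_inv_sqrtE : op_pow dot (op_inv A) (1 / 2) = S'.
Proof.
have [c [d [c0 cd hc]]] := op_pow_bnd_pos Hdot (- (1 / 2)) m0 hA.
apply: (op_sqrt_unique Hdot _ bnd_op_inv c0 cd hc) => [|x]; first by rewrite invr_gt0.
by rewrite op_inv_sqrt.
Qed.

Lemma op_inv_Nsqrt : op_pow dot (op_inv A) (- (1 / 2)) = S.
Proof.
apply/funext => x; have Mi0 : 0 < M^-1 by rewrite invr_gt0.
have := op_powK Hdot (1 / 2) x Mi0 bnd_op_inv; rewrite op_inv_sqrtE => h.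
by rewrite -[LHS]SK h.
Qed.

Lemma geom_mean_invE : geom_mean dot (1 / 2) (op_inv A) B = C.
Proof. by rewrite /geom_mean op_inv_sqrtE op_inv_Nsqrt. Qed.

Lemma bnd_SBS : bnd dot (m * m) (M * M) (S \o B \o S).
Proof. by apply: (bnd_conj (ltW m0) (ltW M0) hB sS) => x; rewrite rdot_sqrt hA.2. Qed.

Lemma bnd_D : bnd dot (m * M^-1) (M * m^-1) D.
Proof. exact: (bnd_conj (ltW m0) (ltW M0) hB sS' rdot_inv_sqrt). Qed.

Let mm0 : 0 < m * m := mulr_gt0 m0 m0.

(** The square root of [m^2 <= S B S <= M^2] has the same bounds as [A], so Kantorovich's inequality
    holds for both with one constant. *)
Lemma bnd_T : bnd dot m M T.
Proof.
apply: (op_pow_bnd Hdot mm0 bnd_SBS) => s /andP[h1 h2].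
have sq (u : R) : 0 < u -> (u * u) `^ (1 / 2) = u.
  by move=> /ltW u0; rewrite -expr2 -(powR_mulrn 2 u0) -powRrM (_ : _ * _ = 1) ?powRr1 //; lra.
have s0 : 0 < s by exact: lt_le_trans h1.
rewrite -{1}(sq m m0) -{1}(sq M M0).
by rewrite !ge0_ler_powR ?nnegrE ?mulr_ge0 ?(ltW m0) ?(ltW M0) ?(ltW s0) //; lra.
Qed.

Lemma rdot_T_sq x : rd (T x) (T x) = rd (B (S x)) (S x).
Proof.
rewrite -(self_adjoint_rdot bnd_T.1) (op_sqrt_sqr Hdot x mm0 bnd_SBS) /=.
exact: (self_adjoint_rdot sS).
Qed.

Lemma bnd_scale (c a b : R) G : 0 <= c -> bnd dot a b G -> bnd dot (c * a) (c * b) (op_scale c G).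
Proof.
move=> c0 hG; split=> [|x]; first exact: self_adjoint_scale hG.1.
by rewrite /op_scale rdotZl -!mulrA; have /andP[h1 h2] := hG.2 x; rewrite !ler_wpM2l.
Qed.

(** [A^2 <= M A] and [m A <= S B S = T^2] combine to [(m / M) A^2 <= T^2]. *)
Lemma T_ge x : Num.sqrt (m / M) * rd (A x) x <= rd (T x) x.
Proof.
set c := Num.sqrt _; have c0 : 0 < c by rewrite sqrtr_gt0 divr_gt0.
have hc := bnd_scale (ltW c0) hA.
have cm0 : 0 < c * m by rewrite mulr_gt0.
rewrite -rdotZl -/(op_scale c A x).
(* [sqrt_monotone] wants common bounds for its two operators, hence the minimum and maximum over
   those of [c A] and [T]. *)
apply: (@sqrt_monotone _ _ _ Hdot (Num.min (c * m) m) (Num.max (c * M) M)) => [||||y].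
- by rewrite lt_min cm0.
- by rewrite ge_min !le_max mM !orbT.
- by apply: (bnd_weaken Hdot _ _ hc); rewrite ?ge_min ?le_max lexx.
- by apply: (bnd_weaken Hdot _ _ bnd_T); rewrite ?ge_min ?le_max lexx orbT.
rewrite rdot_T_sq /op_scale rdotZl rdotZr mulrA -expr2 sqr_sqrtr ?divr_ge0 ?(ltW m0) ?(ltW M0) //.
have /andP[h1 _] := hB.2 (S y); apply: le_trans h1; rewrite rdot_sqrt.
have hA0 : bnd dot 0 M A by apply: (bnd_weaken Hdot _ _ hA) => //; exact: ltW.
have := bnd_sq_le Hdot y hA0; rewrite !mul0r addr0 add0r => h.
by rewrite mulrAC ler_pdivrMr // -mulrA ler_wpM2l ?(ltW m0) // mulrC.
Qed.

(** Here [T^2 = S B S <= M A] and [m A <= A^2]. *)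
Lemma T_le x : rd (T x) x <= Num.sqrt (M / m) * rd (A x) x.
Proof.
set c := Num.sqrt _; have c0 : 0 < c by rewrite sqrtr_gt0 divr_gt0.
have hc := bnd_scale (ltW c0) hA.
have cm0 : 0 < c * m by rewrite mulr_gt0.
rewrite -rdotZl -/(op_scale c A x).
apply: (@sqrt_monotone _ _ _ Hdot (Num.min (c * m) m) (Num.max (c * M) M)) => [||||y].
- by rewrite lt_min cm0.
- by rewrite ge_min !le_max mM !orbT.
- by apply: (bnd_weaken Hdot _ _ bnd_T); rewrite ?ge_min ?le_max lexx orbT.
- by apply: (bnd_weaken Hdot _ _ hc); rewrite ?ge_min ?le_max lexx.
rewrite rdot_T_sq /op_scale rdotZl rdotZr mulrA -expr2 sqr_sqrtr ?divr_ge0 ?(ltW m0) ?(ltW M0) //.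
have /andP[_ h1] := hB.2 (S y); apply: (le_trans h1); rewrite rdot_sqrt.
have h := bnd_sq_ge Hdot y (ltW m0) hA.
by rewrite mulrAC ler_pdivlMr // -mulrA ler_wpM2l ?(ltW M0) // mulrC.
Qed.

Lemma bnd_C : bnd dot (Num.sqrt (m / M)) (Num.sqrt (M / m)) C.
Proof.
split=> [|x]; first exact: (self_adjoint_conj bnd_T.1 sS').
have e : rd x x = rd (A (S' x)) (S' x) by rewrite -rdot_sqrt SK.
by rewrite /= (self_adjoint_rdot sS') e T_ge T_le.
Qed.

Theorem geom_mean_le_spectral t : 0 <= t <= 1 ->
  op_le dot (geom_mean dot t A B)
    (op_scale
      (1 / kantorovich (Num.sqrt (m / M)) (Num.sqrt (M / m)) t ^+ 2
         * ((M + m) ^+ 2 / (4 * M * m)))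
      (spectral_geom_mean dot t A B)).
Proof.
move=> t01; rewrite /spectral_geom_mean geom_mean_invE /geom_mean.
set a := Num.sqrt (m / M); set b := Num.sqrt (M / m).
have a0 : 0 < a by rewrite sqrtr_gt0 divr_gt0.
have d0 : 0 < m * M^-1 by rewrite divr_gt0.
have ab : a <= b.
  rewrite ler_sqrt ?divr_gt0 // (@le_trans _ _ 1) ?ler_pdivrMr ?ler_pdivlMr ?mul1r //.
have sC := op_pow_self_adjoint Hdot t a0 bnd_C.
have sD := op_pow_self_adjoint Hdot t d0 bnd_D.
apply: op_leP; first exact: self_adjoint_conj sD sS.
  by apply: self_adjoint_scale; exact: self_adjoint_conj hA.1 sC.
set Ct := op_pow dot C t in sC *; set Dt := op_pow dot D t in sD *.
move=> x; pose v := S' x; have xv : x = S v by rewrite SK.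
rewrite /op_scale rdotZl /= (self_adjoint_rdot sS) (self_adjoint_rdot sC) -(rdot_sqrt (Ct x)).
have -> : S x = A v by rewrite xv SS.
(* The scalar comparison needs [|v|^2], [p] and [q] positive; for [v = 0] both sides vanish. *)
have [v0|vn0] := eqVneq v 0.
  have lA := self_adjoint_real_linear Hdot hA.1.
  rewrite v0 (real_linear0 lA) rdotC rdot0l; have -> : x = 0.
    by rewrite xv v0 (real_linear0 (self_adjoint_real_linear Hdot sS)).
  rewrite (real_linear0 (self_adjoint_real_linear Hdot sC)).
  by rewrite (real_linear0 (self_adjoint_real_linear Hdot sS)) rdot0l mulr0.
have n0 : 0 < rd v v.
  rewrite lt0r (rdot_ge0 Hdot) andbT -(nrm_sq Hdot) sqrf_eq0.
  by apply: contraNneq vn0 => /nrm_eq0 ->.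
have [c [d [c0 e0 K0 hline hK]]] := kantorovich_line a0 ab t01.
have p0 : 0 < rd (A v) v by have /andP[h _] := hA.2 v; apply: lt_le_trans h; rewrite mulr_gt0.
have q0 : 0 < rd (T v) v by have /andP[h _] := bnd_T.2 v; apply: lt_le_trans h; rewrite mulr_gt0.
apply: (mean_comparison (t := t) t01 K0 _ n0 p0 q0 (rdot_ge0 Hdot (T v)) _ _
  (w := rd (S (Ct x)) v)).
- by rewrite divr_ge0 ?sqr_ge0 // !mulr_ge0 // ltW.
- exact: (bnd_kantorovich Hdot v m0 mM hA).
- exact: (bnd_kantorovich Hdot v m0 mM bnd_T).
- apply: (le_trans (hK _ _ p0 q0)); rewrite (self_adjoint_rdot sS) -xv.
  have := op_pow_ge_line Hdot x a0 bnd_C hline; apply: le_trans.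
  have -> : rd (C x) x = rd (T v) v by rewrite /= (self_adjoint_rdot sS').
  have -> : rd x x = rd (A v) v by rewrite -rdot_sqrt -xv.
  by rewrite addrC.
- have h := abs_rdot_le Hdot (S (Ct x)) v.
  rewrite -(nrm_sq Hdot) -(nrm_sq Hdot v) -exprMn -[leLHS]real_normK ?num_real //.
  by rewrite ler_sqr ?nnegrE ?mulr_ge0 ?nrm_ge0.
move=> l l0; have hl s : m * M^-1 <= s <= M * m^-1 ->
    s `^ t <= l `^ t * t / l * s + l `^ t * (1 - t).
  move=> /andP[h _]; have s0 : 0 < s by exact: lt_le_trans h.
  apply: (le_trans (powR_le_tangent s0 l0 t01)); rewrite le_eqVlt; apply/orP; left.
  by apply/eqP; ring.
apply: (le_trans (op_pow_le_line Hdot (A v) d0 bnd_D hl)).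
(* [D A v = S' B S v], so the form equals [<B S v, S v>]: this is the bridge from [D] to [T]. *)
have -> : rd (D (A v)) (A v) = rd (T v) (T v).
  by rewrite /= (self_adjoint_rdot sS') -SS !SK' rdot_T_sq.
by rewrite le_eqVlt; apply/orP; left; apply/eqP; ring.
Qed.

End GeometricMeans.

Theorem corollary2p3 (R : realType) (H : completeNormedModType R[i])
    (dot : {dot H for Num.conj}) (Hdot : norm_induced_by dot)
    (A B : {linear H -> H}) (bA : bounded_near A (nbhs 0))
    (bB : bounded_near B (nbhs 0))
    (m M : R) (m_gt0 : 0 < m)
    (hA : between dot m M A) (hB : between dot m M B)
    (t : R) (t_ge0 : 0 <= t) (t_le1 : t <= 1) :
  op_le dot (geom_mean dot t A B)
    (op_scale
      (1 / kantorovich (Num.sqrt (m / M)) (Num.sqrt (M / m)) t ^+ 2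
         * ((M + m) ^+ 2 / (4 * M * m)))
      (spectral_geom_mean dot t A B)).
Proof.
have {}hA : bnd dot m M A by exact/betweenP.
have {}hB : bnd dot m M B by exact/betweenP.
have [mM|mM] := boolP (m <= M).
  by apply: (geom_mean_le_spectral Hdot m_gt0 mM hA hB); rewrite t_ge0.
(* Otherwise [H = 0]. *)
have z x : x = 0 :> H by apply: nrm_eq0; exact: (bnd_nrm0 Hdot x hA mM).
have sa G : self_adjoint dot G by move=> x y; rewrite (z x) (z y) (z (G 0)).
apply: op_leP => // x; first by rewrite (z x) rdotC rdot0l rdotC rdot0l.
Qed.
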